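(* Let $\alpha: G \curvearrowright \mathcal{A}$ be a non-trivial action of a finite group $G$ on a unital abelian $C^*$-algebra $\mathcal{A}$. Then $\mathcal{A}^G \subseteq \mathcal{A}$ has multiple pseudo-expectations. Likewise $\mathcal{A} \rtimes_{\alpha,r} G \subseteq \mathcal{A} \otimes B(\ell^2(G))$ has multiple pseudo-expectations.
   Context: An action $\alpha: G \curvearrowright \mathcal{A}$ is a homomorphism $\alpha: G \to \operatorname{Aut}(\mathcal{A})$, $g \mapsto \alpha_g$; it is non-trivial if $\alpha_g \neq \operatorname{id}$ for some $g \in G$. $\mathcal{A}^G = \{a \in \mathcal{A} : \alpha_g(a) = a \ \forall g \in G\}$. For $G$ finite, the reduced crossed product $\mathcal{A} \rtimes_{\alpha,r} G$ is identified with the $C^*$-subalgebra of $\mathcal{A} \otimes B(\ell^2(G))$ generated by the elements $\sum_{g} \alpha_g^{-1}(a) \otimes E_{g,g}$ ($a \in \mathcal{A}$) and $1 \otimes \lambda_g$ ($g \in G$), where $\lambda$ is the left regular representation and $E_{g,h} \in B(\ell^2(G))$ is the rank-one operator (matrix unit) with $E_{g,h}\delta_h = \delta_g$. For an inclusion $\mathcal{C} \subseteq \mathcal{B}$ of unital $C^*$-algebras with common unit, a pseudo-expectation is a unital completely positive map $\Psi: \mathcal{B} \to I(\mathcal{C})$ with $\Psi(c) = c$ for all $c \in \mathcal{C}$, where $I(\mathcal{C})$ is the (Hamana) injective envelope of $\mathcal{C}$ (the unique minimal injective operator system containing $\mathcal{C}$; it is a $C^*$-algebra containing $\mathcal{C}$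 as a $C^*$-subalgebra). ''Multiple'' means more than one. *)

(* Defs.v *)
From HB Require Import structures.
From mathcomp Require Import all_boot all_order all_algebra all_fingroup.
From mathcomp Require Import complex.
From mathcomp Require Import all_classical all_reals all_analysis.

Set Implicit Arguments.
Unset Strict Implicit.
Unset Printing Implicit Defensive.

Import Order.TTheory GRing.Theory Num.Theory.
Import numFieldNormedType.Exports.

Local Open Scope classical_set_scope.
Local Open Scope ring_scope.
Local Open Scope complex_scope.

(* [algType] carries [1 != 0], so the zero algebra is excluded; it has no
   non-trivial action, and it is not the ambient algebra or the injective
   envelope of any inclusion of nonzero algebras. *)
HB.mixin Record hasStar (R : realType) A of GRing.Algebra R[i] A := {
  star : A -> A;
  starK : involutive star;
  starD : {morph star : x y / x + y};
  starZ : forall (a : R[i]) (x : A), star (a *: x) = a^* *: star x;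
  starM : forall x y : A, star (x * y) = star y * star x
}.

#[short(type="starAlgType")]
HB.structure Definition StarAlgebra (R : realType) :=
  {A of GRing.Algebra R[i] A & hasStar R A}.

#[short(type="topStarAlgType")]
HB.structure Definition TopStarAlgebra (R : realType) :=
  {A of StarAlgebra R A & Topological A}.

HB.mixin Record isCStar (R : realType) A of TopStarAlgebra R A := {
  cnorm : A -> R;
  cnorm0_eq0 : forall x : A, cnorm x = 0 -> x = 0;
  cnormZ : forall (a : R[i]) (x : A), (cnorm (a *: x))%:C = `|a| * (cnorm x)%:C;
  ler_cnormD : forall x y : A, cnorm (x + y) <= cnorm x + cnorm y;
  ler_cnormM : forall x y : A, cnorm (x * y) <= cnorm x * cnorm y;
  cnorm_starM : forall x : A, cnorm (star x * x) = cnorm x ^+ 2;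
  nbhs_cnorm : forall x : A, nbhs x = nbhs_ball_ (ball_ cnorm) x;
  cnorm_complete : forall u : nat -> A,
    (forall e : R, 0 < e -> exists N : nat, forall m n : nat,
      (N <= m)%N -> (N <= n)%N -> cnorm (u m - u n) < e) ->
    exists l : A, u @ \oo --> l
}.

#[short(type="cstarAlgType")]
HB.structure Definition CStarAlgebra (R : realType) :=
  {A of TopStarAlgebra R A & isCStar R A}.

Section StarAlgebras.
Variable R : realType.
Implicit Types A B D : starAlgType R.

Definition mxadj B n (M : 'M[B]_n) : 'M[B]_n := (map_mx star M)^T.

(* The positive elements of the C*-algebra M_n(B). *)
Definition mxpositive B n (M : 'M[B]_n) : Prop :=
  exists N : 'M[B]_n, M = mxadj N *m N.

Definition linear_subspace B (S : set B) : Prop :=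
  S 0 /\ forall (a : R[i]) (x y : B), S x -> S y -> S (a *: x + y).

Definition operator_system B (S : set B) : Prop :=
  [/\ linear_subspace S, S 1 & forall x, S x -> S (star x)].

Definition linear_on B D (S : set B) (f : B -> D) : Prop :=
  forall (a : R[i]) (x y : B), S x -> S y -> f (a *: x + y) = a *: f x + f y.

(* [f] restricts to a unital completely positive map on the operator system
   [S]; the values of [f] outside [S] are irrelevant. *)
Definition ucp_on B D (S : set B) (f : B -> D) : Prop :=
  [/\ linear_on S f, f 1 = 1 &
    forall n (M : 'M[B]_n),
      (forall i j, S (M i j)) -> mxpositive M -> mxpositive (map_mx f M)].

(* [f] restricts to a unital *-homomorphism on the unital *-subalgebra [S]. *)
Definition star_hom_on B D (S : set B) (f : B -> D) : Prop :=
  [/\ linear_on S f, f 1 = 1,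
      forall x y, S x -> S y -> f (x * y) = f x * f y &
      forall x, S x -> f (star x) = star (f x)].

Definition star_automorphism A (f : A -> A) : Prop :=
  star_hom_on [set: A] f /\ bijective f.

Definition star_action A (gT : finGroupType) (alpha : gT -> A -> A) : Prop :=
  (forall g, star_automorphism (alpha g)) /\
  (forall g h, alpha (g * h)%g = alpha g \o alpha h).

Definition fixed_points A (gT : finGroupType) (alpha : gT -> A -> A) : set A :=
  [set a | forall g, alpha g a = a].

End StarAlgebras.

Definition cstar_subalgebra (R : realType) (B : topStarAlgType R)
    (S : set B) : Prop :=
  [/\ linear_subspace S,
      forall x y, S x -> S y -> S (x * y),
      forall x, S x -> S (star x) &
      closed S].

Definition generated_cstar_subalgebra (R : realType) (B : topStarAlgType R) :
  set B -> set B := smallest (@cstar_subalgebra R B).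

Section InjectiveEnvelope.
Variable R : realType.

(* Operator systems are unital self-adjoint subspaces of unital C*-algebras. *)
Definition injective_operator_system (I : cstarAlgType R) (W : set I) : Prop :=
  operator_system W /\
  forall (B : cstarAlgType R) (E F : set B) (phi : B -> I),
    operator_system E -> operator_system F -> E `<=` F ->
    ucp_on E phi -> (forall x, E x -> W (phi x)) ->
    exists psi : B -> I,
      [/\ ucp_on F psi, forall x, F x -> W (psi x) &
          forall x, E x -> psi x = phi x].

(* [I] contains a copy [iota @` C] of the C*-algebra [C], and is minimal among
   the injective operator systems containing it. *)
Definition injective_envelope (B : starAlgType R) (C : set B)
    (I : cstarAlgType R) (iota : B -> I) : Prop :=
  [/\ star_hom_on C iota,
      forall x y, C x -> C y -> iota x = iota y -> x = y,
      injective_operator_system [set: I] &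
      forall W : set I, injective_operator_system W ->
        iota @` C `<=` W -> W = [set: I]].

Definition pseudo_expectation (B : starAlgType R) (C : set B)
    (I : cstarAlgType R) (iota : B -> I) (Psi : B -> I) : Prop :=
  ucp_on [set: B] Psi /\ forall c, C c -> Psi c = iota c.

(* The injective envelope exists, and is unique up to a *-isomorphism fixing
   [C]; hence quantifying over all its models [(I, iota)]. *)
Definition multiple_pseudo_expectations (B : starAlgType R) (C : set B) :
    Prop :=
  forall (I : cstarAlgType R) (iota : B -> I),
    injective_envelope C iota ->
    exists Psi1 Psi2 : B -> I,
      [/\ pseudo_expectation C iota Psi1, pseudo_expectation C iota Psi2 &
          Psi1 <> Psi2].

End InjectiveEnvelope.

(* A (x) B(l^2(G)), for a finite group G, as the algebra of G x G matrices over
   A, with [g : G] numbered by [enum_rank g].  The type is an alias because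
   MathComp's matrices over A are already a module over A instead of R[i].  The
   topology is MathComp-Analysis's entrywise one; it is the topology of the
   C*-norm, since max |x_(g,h)| <= |x| <= \sum |x_(g,h)|. *)
Definition tensorB (R : realType) (A : cstarAlgType R) (gT : finGroupType) :
  Type := 'M[A]_#|gT|.

Section TensorB.
Variables (R : realType) (A : cstarAlgType R) (gT : finGroupType).
Local Notation T := (tensorB A gT).

HB.instance Definition _ := Topological.copy T 'M[A]_#|gT|.
HB.instance Definition _ := GRing.Zmodule.copy T 'M[A]_#|gT|.

Let tmul (x y : T) : T := x *m y.
Let tone : T := 1%:M.
Let tscale (a : R[i]) (x : T) : T := map_mx ( *:%R a) x.
Let tstar (x : T) : T := mxadj x.

Let tmulA : associative tmul. Proof. exact: mulmxA. Qed.
Let tmul1 : left_id tone tmul. Proof. exact: mul1mx. Qed.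
Let tmulr1 : right_id tone tmul. Proof. exact: mulmx1. Qed.
Let tmulDl : left_distributive tmul +%R. Proof. exact: mulmxDl. Qed.
Let tmulDr : right_distributive tmul +%R. Proof. exact: mulmxDr. Qed.
Let tone_neq0 : tone != 0.
Proof.
apply/eqP => /matrixP /(_ (enum_rank 1%g) (enum_rank 1%g)).
by rewrite !mxE eqxx; apply/eqP; rewrite oner_eq0.
Qed.

HB.instance Definition _ := GRing.Zmodule_isNzRing.Build T
  tmulA tmul1 tmulr1 tmulDl tmulDr tone_neq0.

Let tscaleA a b v : tscale a (tscale b v) = tscale (a * b) v.
Proof. by apply/matrixP=> i j; rewrite !mxE scalerA. Qed.
Let tscale1 : left_id 1 tscale.
Proof. by move=> v; apply/matrixP=> i j; rewrite !mxE scale1r. Qed.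
Let tscaleDr : right_distributive tscale +%R.
Proof. by move=> a u v; apply/matrixP=> i j; rewrite !mxE scalerDr. Qed.
Let tscaleDl v : {morph tscale^~ v : a b / a + b}.
Proof. by move=> a b; apply/matrixP=> i j; rewrite !mxE scalerDl. Qed.

HB.instance Definition _ := GRing.Zmodule_isLmodule.Build R[i] T
  tscaleA tscale1 tscaleDr tscaleDl.

Let tscaleAl (a : R[i]) (u v : T) : a *: (u * v) = (a *: u) * v.
Proof.
apply/matrixP=> i j; rewrite !mxE scaler_sumr.
by apply: eq_bigr => k _; rewrite !mxE scalerAl.
Qed.
Let tscaleAr (a : R[i]) (u v : T) : a *: (u * v) = u * (a *: v).
Proof.
apply/matrixP=> i j; rewrite !mxE scaler_sumr.
by apply: eq_bigr => k _; rewrite !mxE scalerAr.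
Qed.

HB.instance Definition _ := GRing.Lmodule_isLalgebra.Build R[i] T tscaleAl.
HB.instance Definition _ := GRing.Lalgebra_isAlgebra.Build R[i] T tscaleAr.

Let star0 : star (0 : A) = 0.
Proof. by apply: (addrI (star 0)); rewrite -starD !addr0. Qed.
Let tstarK : involutive tstar.
Proof. by move=> x; apply/matrixP=> i j; rewrite !mxE starK. Qed.
Let tstarD : {morph tstar : x y / x + y}.
Proof. by move=> x y; apply/matrixP=> i j; rewrite !mxE starD. Qed.
Let tstarZ (a : R[i]) (x : T) : tstar (a *: x) = a^* *: tstar x.
Proof. by apply/matrixP=> i j; rewrite !mxE starZ. Qed.
Let tstarM (x y : T) : tstar (x * y) = tstar y * tstar x.
Proof.
apply/matrixP=> i j; rewrite !mxE (big_morph _ (@starD R A) star0).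
by apply: eq_bigr => k _; rewrite !mxE starM.
Qed.

HB.instance Definition _ := hasStar.Build R T tstarK tstarD tstarZ tstarM.

(* The elementary tensor a (x) t. *)
Definition tens (a : A) (t : 'M[R[i]]_#|gT|) : T := \matrix_(i, j) (t i j *: a).

Definition mxunit (g h : gT) : 'M[R[i]]_#|gT| :=
  delta_mx (enum_rank g) (enum_rank h).

(* lambda_g maps the basis vector delta_h to delta_(g h). *)
Definition left_regular (g : gT) : 'M[R[i]]_#|gT| :=
  \sum_(h : gT) mxunit (g * h)%g h.

Definition crossed_product (alpha : gT -> A -> A) : set T :=
  generated_cstar_subalgebra
    ([set \sum_(g : gT) tens (alpha g^-1%g a) (mxunit g g) | a in [set: A]] `|`
     [set tens 1 (left_regular g) | g in [set: gT]]).

End TensorB.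

(* Main.v *)
(* For a finite group G acting on a *-algebra T, each weight k commuting with
   C = T^G and satisfying E(k* k) = 1, where E is the average over G, yields the
   pseudo-expectation x |-> iota (E(k* x k)) of C in T.  The weight k = 1 gives
   iota o E.  If h is a nonzero self-adjoint element of A with E(h) = 0 and
   |h| <= 1, then k = sqrt(1 - h) is another weight, and the two maps differ at
   1 - h because E(h^2) <> 0.  The crossed product is the fixed-point algebra of
   alpha (x) Ad rho on A (x) B(l^2 G), rho being the right regular representation,
   and A (x) 1 commutes with it, so the same weight serves both inclusions.

   Complete positivity into the envelope needs E(N* N) to be a square of a
   self-adjoint matrix with entries in C.  Over a commutative A, a self-adjoint
   matrix M with <v, M v> >= 0 for all v has a square root that is a limit of
   polynomials in M: square roots of 1 - x, for a contraction x, come from the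
   iteration z := b + z^2 with b = x / 4, whose limit satisfies
   (1 - 2 z)^2 = 1 - x. *)
Require Import Defs.
From HB Require Import structures.
From mathcomp Require Import all_boot all_order all_algebra all_fingroup.
From mathcomp Require Import complex ring lra.
From mathcomp Require Import all_classical all_reals all_analysis.

Set Implicit Arguments.
Unset Strict Implicit.
Unset Printing Implicit Defensive.

Import Order.TTheory GRing.Theory Num.Theory.

Local Open Scope classical_set_scope.
Local Open Scope ring_scope.
Local Open Scope complex_scope.

(* Commutativity as a structure rather than a hypothesis makes the theory of
   commutative rings available on A. *)
#[short(type="comCstarAlgType")]
HB.structure Definition ComCStarAlgebra (R : realType) :=
  {A of CStarAlgebra R A & GRing.PzRing_hasCommutativeMul A}.

(** * Real scalars and the norm of a C*-algebra *)

Section RealScalars.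
Variable R : realType.

Lemma conj_realC (a : R) : Num.conj a%:C = a%:C.
Proof. exact: conjc_real. Qed.

Lemma conj_i : Num.conj ('i : R[i]) = - 'i.
Proof. by rewrite /Num.conj /=; simpc. Qed.

Lemma norm_realC (a : R) : `|a%:C| = `|a|%:C.
Proof. by rewrite normc_def /= expr0n addr0 sqrtr_sqr. Qed.

Lemma mulii : ('i : R[i]) * 'i = -1.
Proof. by apply/eqP; rewrite eq_complex /=; apply/andP; split; apply/eqP; ring. Qed.

Variable A : starAlgType R.

(** Packaged below as a ring morphism, so that over a commutative algebra [ring] proves identities
    mixing real scalars and elements. *)
Definition rs (r : R) : A := (r%:C)%:A.

Lemma rs_zmod_morphism : zmod_morphism rs.
Proof. by move=> a b; rewrite /rs rmorphB scalerBl. Qed.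

Lemma rs_monoid_morphism : monoid_morphism rs.
Proof.
by split=> [|a b]; rewrite /rs ?rmorph1 ?scale1r // rmorphM mulr_algl scalerA.
Qed.

HB.instance Definition _ := GRing.isZmodMorphism.Build R A rs rs_zmod_morphism.
HB.instance Definition _ :=
  GRing.isMonoidMorphism.Build R A rs rs_monoid_morphism.

Lemma rsM r x : rs r * x = r%:C *: x. Proof. exact: mulr_algl. Qed.

Lemma rs_comm r x : rs r * x = x * rs r.
Proof. by rewrite rsM [RHS]mulr_algr. Qed.

Lemma star0 : star (0 : A) = 0.
Proof. by apply: (addrI (star 0)); rewrite -starD !addr0. Qed.

Lemma starN (x : A) : star (- x) = - star x.
Proof. by apply: (addrI (star x)); rewrite -starD !subrr star0. Qed.

Lemma starB (x y : A) : star (x - y) = star x - star y.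
Proof. by rewrite starD starN. Qed.

Lemma star_sum (I : Type) (r : seq I) (P : pred I) (F : I -> A) :
  star (\sum_(i <- r | P i) F i) = \sum_(i <- r | P i) star (F i).
Proof. exact: (big_morph _ (@starD R A) star0). Qed.

Lemma star1 : star (1 : A) = 1.
Proof. by have := starM (1 : A) (star 1); rewrite mul1r starK mul1r => <-. Qed.

Lemma star_rs r : star (rs r) = rs r.
Proof. by rewrite /rs starZ conj_realC star1. Qed.

End RealScalars.
Arguments rs {R A} r.

Section CNorm.
Variables (R : realType) (A : cstarAlgType R).
Implicit Types x y : A.

Lemma cnorm_real (r : R) x : cnorm (rs r * x) = `|r| * cnorm x.
Proof.
apply/(@complexI R); rewrite rsM cnormZ norm_realC.
by rewrite -rmorphM.
Qed.

Lemma cnormN x : cnorm (- x) = cnorm x.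
Proof.
have -> : - x = rs (-1) * x by rewrite rmorphN1 mulN1r.
by rewrite cnorm_real normrN1 mul1r.
Qed.

Lemma cnormB x y : cnorm (x - y) = cnorm (y - x).
Proof. by rewrite -cnormN opprB. Qed.

Lemma cnorm0 : cnorm (0 : A) = 0.
Proof. by have := cnorm_real 0 (0 : A); rewrite mulr0 normr0 mul0r. Qed.

(** Not an axiom of [cnorm]: it follows from 0 = |x - x| <= 2 |x|. *)
Lemma cnorm_ge0 x : 0 <= cnorm x.
Proof.
have := ler_cnormD x (- x); rewrite subrr cnorm0 cnormN; lra.
Qed.

Lemma cnorm_eq0 x : cnorm x <= 0 -> x = 0.
Proof.
by move=> x0; apply: cnorm0_eq0; apply/eqP; rewrite eq_le x0 cnorm_ge0.
Qed.

Lemma ler_cnorm_trans y x z : cnorm (x - z) <= cnorm (x - y) + cnorm (y - z).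
Proof. by apply: le_trans (ler_cnormD _ _); rewrite addrA subrK. Qed.

(** Submultiplicativity and the C*-identity give |y|^2 <= |y*| |y|; then y and y* exchange roles. *)
Lemma cnorm_star x : cnorm (star x) = cnorm x.
Proof.
suff le y : cnorm y <= cnorm (star y).
  by apply/eqP; rewrite eq_le le -{2}(starK x) le.
have := ler_cnormM (star y) y; rewrite cnorm_starM.
have := cnorm_ge0 y; have := cnorm_ge0 (star y) => s0 y0 h.
by rewrite leNgt; apply/negP => lt; nra.
Qed.

Lemma cnorm_sqr x : star x = x -> cnorm (x * x) = cnorm x ^+ 2.
Proof. by move=> {1}<-; rewrite cnorm_starM. Qed.

Lemma cnorm1 : cnorm (1 : A) = 1.
Proof.
have : cnorm (1 : A) != 0.
  by apply/negP => /eqP /cnorm0_eq0 /eqP; rewrite oner_eq0.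
have := cnorm_sqr (@star1 R A); rewrite mulr1 expr2 => h n0.
by apply: (mulfI n0); rewrite -h mulr1.
Qed.

Lemma cnorm_rs (r : R) : cnorm (rs r : A) = `|r|.
Proof. by rewrite -[rs r]mulr1 cnorm_real cnorm1 mulr1. Qed.

Lemma ler_cnorm_sum (I : finType) (F : I -> A) :
  cnorm (\sum_i F i) <= \sum_i cnorm (F i).
Proof.
elim/big_ind2: _ => [|x a y b xa yb|//]; first by rewrite cnorm0.
by apply: le_trans (ler_cnormD _ _) _; apply: lerD.
Qed.

(** Completeness with an explicit rate: the Cauchy estimate survives the passage to the limit. *)
Lemma cnorm_limit (u : nat -> A) (rho : nat -> R) :
  (forall e, 0 < e -> exists N, forall k, (N <= k)%N -> rho k < e) ->
  (forall k m, (k <= m)%N -> cnorm (u m - u k) <= rho k) ->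
  exists l, forall k, cnorm (l - u k) <= rho k.
Proof.
move=> rho0 uC.
have [e e0|l ul] := @cnorm_complete R A u.
  have [N hN] := rho0 (e / 2) (divr_gt0 e0 (ltr0n _ 2)).
  exists N => m n Nm Nn.
  have := ler_cnorm_trans (u N) (u m) (u n).
  have := uC N m Nm; have := uC N n Nn; rewrite (cnormB (u n)).
  have := hN N (leqnn N); lra.
exists l => k; apply/ler_addgt0Pr => e e0.
have : nbhs l [set y | cnorm (l - y) < e].
  by rewrite nbhs_cnorm; exists e.
move=> /ul [N _ hN].
have := hN (maxn N k) (leq_maxl _ _); have := uC k (maxn N k) (leq_maxr _ _).
have := ler_cnorm_trans (u (maxn N k)) l (u k); rewrite /=; lra.
Qed.

End CNorm.

(** * The entrywise sum norm on matrices *)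

Section SumNorm.
Variables (R : realType) (A : cstarAlgType R).

(** Being submultiplicative and equivalent to entrywise convergence, it replaces the C*-norm of
    M_n(A) in limit arguments. *)
Definition snorm m n (X : 'M[A]_(m, n)) : R := \sum_i \sum_j cnorm (X i j).

Definition snorm_closed m n (Q : 'M[A]_(m, n) -> Prop) : Prop :=
  forall X, (forall e, 0 < e -> exists Y, Q Y /\ snorm (X - Y) <= e) -> Q X.

Lemma snorm_ge0 m n (X : 'M[A]_(m, n)) : 0 <= snorm X.
Proof. by do 2! apply: sumr_ge0 => ? _; exact: cnorm_ge0. Qed.

Lemma cnorm_entry m n (X : 'M[A]_(m, n)) i j : cnorm (X i j) <= snorm X.
Proof.
rewrite /snorm (bigD1 i) //= (bigD1 j) //= -addrA lerDl addr_ge0 //.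
  by apply: sumr_ge0 => ? _; exact: cnorm_ge0.
by do 2! apply: sumr_ge0 => ? _; exact: cnorm_ge0.
Qed.

Lemma snorm_le m n (X : 'M[A]_(m, n)) c :
  (forall i j, cnorm (X i j) <= c) -> snorm X <= (m * n)%:R * c.
Proof.
move=> Xc; apply: (@le_trans _ _ (\sum_(i < m) \sum_(j < n) c)).
  by do 2! apply: ler_sum => ? _.
by rewrite !sumr_const !card_ord -mulrnA mulr_natl mulnC.
Qed.

Lemma snorm_eq0 m n (X : 'M[A]_(m, n)) : snorm X <= 0 -> X = 0.
Proof.
move=> X0; apply/matrixP=> i j; rewrite mxE; apply: cnorm_eq0.
exact: le_trans (cnorm_entry X i j) X0.
Qed.

(** Used to pass matrix equations to the limit: the defect is shown to be of order e for every e >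
    0. *)
Lemma snorm_small m n (X : 'M[A]_(m, n)) (K : R) :
  (forall e, 0 < e -> snorm X <= K * e) -> X = 0.
Proof.
move=> h; apply: snorm_eq0; apply/ler_addgt0Pr => e e0; rewrite add0r.
have K0 : 0 < `|K| + 1 by rewrite ltr_wpDl.
apply: le_trans (h (e / (`|K| + 1)) _) _; first exact: divr_gt0.
rewrite mulrA ler_pdivrMr // mulrC ler_pM2l //.
by rewrite (le_trans (ler_norm K)) // lerDl.
Qed.

Lemma snormD m n (X Y : 'M[A]_(m, n)) : snorm (X + Y) <= snorm X + snorm Y.
Proof.
rewrite /snorm -big_split; apply: ler_sum => i _; rewrite -big_split.
by apply: ler_sum => j _; rewrite mxE; exact: ler_cnormD.
Qed.

Lemma snormN m n (X : 'M[A]_(m, n)) : snorm (- X) = snorm X.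
Proof. by do 2! apply: eq_bigr => ? _; rewrite mxE cnormN. Qed.

Lemma snormB m n (X Y : 'M[A]_(m, n)) : snorm (X - Y) <= snorm X + snorm Y.
Proof. by rewrite -(snormN Y); exact: snormD. Qed.

Lemma snormM m n p (X : 'M[A]_(m, n)) (Y : 'M[A]_(n, p)) :
  snorm (X *m Y) <= snorm X * snorm Y.
Proof.
have row_le i l : cnorm (X i l) * \sum_k cnorm (Y l k) <= cnorm (X i l) * snorm Y.
  apply: ler_wpM2l; first exact: cnorm_ge0.
  rewrite /snorm (bigD1 l) //= lerDl.
  by do 2! apply: sumr_ge0 => ? _; exact: cnorm_ge0.
rewrite /snorm mulr_suml; apply: ler_sum => i _.
apply: (@le_trans _ _ (\sum_k \sum_l cnorm (X i l) * cnorm (Y l k))).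
  apply: ler_sum => k _; rewrite mxE; apply: le_trans (ler_cnorm_sum _) _.
  by apply: ler_sum => l _; exact: ler_cnormM.
rewrite exchange_big mulr_suml /=; apply: ler_sum => l _.
by rewrite -mulr_sumr; exact: row_le.
Qed.

End SumNorm.

(** * Convergence of the square root iteration *)

Section SquareRootIteration.
Variables (R : realType) (A : cstarAlgType R) (n : nat).
Implicit Types (b x y z : 'M[A]_n) (c d : R).

(* The limit z satisfies (1/2 - z)^2 = 1/4 - b. *)
Fixpoint sqrt_iter b k :=
  if k is k'.+1 then b + sqrt_iter b k' *m sqrt_iter b k' else b.

(** The scalar majorant: the same iteration at b = 1/4, increasing to the fixed point 1/2 of t = 1/4
    + t^2. *)
Fixpoint sqrt_mass k : R :=
  if k is k'.+1 then 1 / 4 + sqrt_mass k' ^+ 2 else 1 / 4.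

(** The lower bound is the rate of convergence. With a = 1/(k+2), the next term is at least 1/2 - (a
    - a^2), and a - a^2 <= 1/(k+3) because (a - a^2)(k+3) = 1 - a^2. *)
Lemma sqrt_massP k :
  [/\ 0 < sqrt_mass k, sqrt_mass k < 1 / 2 & 1 / 2 - (k.+2%:R)^-1 <= sqrt_mass k].
Proof.
elim: k => [|k [t0 th tl]] /=; first by split; lra.
have k0 : 0 < k.+2%:R :> R by rewrite ltr0n.
have k1 : 0 < k.+3%:R :> R by rewrite ltr0n.
have e : k.+3%:R = k.+2%:R + 1 :> R by rewrite -natr1.
split; [nra|nra|].
have [a aE] : exists a : R, a = (k.+2%:R)^-1 by eexists.
rewrite -aE in tl.
have ak : a * k.+2%:R = 1 by rewrite aE mulVf // gt_eqF.
have a0 : 0 < a by rewrite aE invr_gt0.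
have a2 : a <= 1 / 2.
  by rewrite aE mul1r lef_pV2 ?posrE // ler_nat.
have : (k.+3%:R)^-1 >= a - a ^+ 2 :> R.
  rewrite -div1r ler_pdivlMr // e.
  have -> : (a - a ^+ 2) * (k.+2%:R + 1) = 1 - a ^+ 2 + (a * k.+2%:R - 1) * (1 - a).
    by ring.
  by rewrite ak subrr mul0r addr0 lerBlDr lerDl sqr_ge0.
have : (1 / 2 - a) ^+ 2 <= sqrt_mass k ^+ 2.
  by rewrite ler_pXn2r ?nnegrE //; lra.
by move=> h1; move: (k.+3%:R^-1) => q h2; nra.
Qed.

Lemma sqrt_mass_lt k : sqrt_mass k < sqrt_mass k.+1.
Proof. by have [t0 th _] := sqrt_massP k; rewrite /=; nra. Qed.

(** [B c x] abstracts a bound of x by c, so that the sum norm and the operator bound [contr] share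
    one proof. Sums and products of bounds dominate the iterates by the scalar iteration. The clause
    on Q transfers closed invariants of the iteration to the limit. *)
Lemma sqrt_iter_limit (B : R -> 'M[A]_n -> Prop) (K : R) b :
  (forall c d x y, 0 < c -> 0 < d -> B c x -> B d y -> B (c + d) (x + y)) ->
  (forall c d x y, 0 < c -> 0 < d -> B c x -> B d y -> B (c * d) (x *m y)) ->
  (forall c x, 0 < c -> B c x -> snorm x <= K * c) ->
  B (1 / 4) b ->
  exists z, z = b + z *m z /\
    forall Q, Q b -> (forall x, Q x -> Q (b + x *m x)) -> snorm_closed Q -> Q z.
Proof.
move=> BD BM BK Bb.
set u := sqrt_iter b; set t := sqrt_mass.
have t0 k : 0 < t k by have [] := sqrt_massP k.
have q0 : 0 < 1 / 4 :> R by lra.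
have Bu k : B (t k) (u k).
  elim: k => [|k IH] //=; apply: BD => //; first by rewrite exprn_gt0 // t0.
  by rewrite expr2; apply: BM => //; exact: t0.
(* The increment u^2 - v^2 is written u(u - v) + (u - v)v, which uses only sums and products of
   bounded terms and keeps the noncommutative order. *)
have Bdu k : B (t k.+1 - t k) (u k.+1 - u k).
  elim: k => [|k IH].
    have -> : u 1%N - u 0%N = b *m b by rewrite /u /= addrC addKr.
    have -> : t 1%N - t 0%N = 1 / 4 * (1 / 4) by rewrite /t /=; ring.
    by apply: BM => //; rewrite divr_gt0.
  have -> : u k.+2 - u k.+1 = u k.+1 *m (u k.+1 - u k) + (u k.+1 - u k) *m u k.
    by rewrite mulmxBr mulmxBl addrA subrK /u /= opprD addrACA subrr add0r.
  have -> : t k.+2 - t k.+1 = t k.+1 * (t k.+1 - t k) + (t k.+1 - t k) * t k.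
    by rewrite [t k.+2]/= {3}/t /= -/(t k.+1) -/(t k); ring.
  have d0 : 0 < t k.+1 - t k by rewrite subr_gt0; exact: sqrt_mass_lt.
  by apply: BD; [exact: mulr_gt0|exact: mulr_gt0|exact: BM|exact: BM].
(* Telescoping. The successor keeps the scalar bound strictly positive, as the hypotheses on B
   demand. *)
have Bmu k m : B (t (k + m).+1 - t k) (u (k + m).+1 - u k).
  elim: m => [|m IH]; first by rewrite addn0.
  have -> : u (k + m.+1).+1 - u k =
      (u (k + m.+1).+1 - u (k + m).+1) + (u (k + m).+1 - u k).
    by rewrite addrA subrK.
  have -> : t (k + m.+1).+1 - t k =
      (t (k + m.+1).+1 - t (k + m).+1) + (t (k + m).+1 - t k) by ring.
  apply: BD => //; rewrite ?addnS ?subr_gt0 //; first exact: sqrt_mass_lt.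
  elim: m {IH} => [|m IH]; first by rewrite addn0; exact: sqrt_mass_lt.
  by apply: lt_trans IH _; rewrite addnS; exact: sqrt_mass_lt.
(* All masses lie below 1/2, so 1/(k+2) bounds every later increase of the mass. *)
pose rho k : R := `|K| * (k.+2%:R)^-1.
have rho_ge0 k : 0 <= rho k by rewrite mulr_ge0 // invr_ge0 ler0n.
have rho0 e : 0 < e -> exists N, forall k, (N <= k)%N -> rho k < e.
  move=> e0; exists (Num.trunc (`|K| / e)) => k Nk.
  rewrite /rho ltr_pdivrMr ?ltr0n // mulrC -ltr_pdivrMr //.
  apply: lt_le_trans (truncnS_gt _) _.
  by rewrite ler_nat; apply: leqW.
have uC k m : (k <= m)%N -> snorm (u m - u k) <= rho k.
  move=> km; have [mk|/subnKC <-] := leqP m k.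
    have -> : m = k by apply/eqP; rewrite eqn_leq mk.
    rewrite subrr; apply: le_trans (rho_ge0 k).
    by rewrite /snorm big1 // => ? _; rewrite big1 // => ? _; rewrite mxE cnorm0.
  rewrite addSn; move: (m - k.+1)%N => p.
  have lt : t k < t (k + p).+1.
    elim: p => [|p IH]; first by rewrite addn0; exact: sqrt_mass_lt.
    by apply: lt_trans IH _; rewrite addnS; exact: sqrt_mass_lt.
  apply: le_trans (BK _ _ _ (Bmu k p)) _; first by rewrite subr_gt0.
  apply: (@le_trans _ _ (`|K| * (t (k + p).+1 - t k))).
    by rewrite ler_wpM2r ?ler_norm // subr_ge0 ltW.
  rewrite ler_wpM2l //.
  have [_ _ tk] := sqrt_massP k; have [_ tp _] := sqrt_massP (k + p).+1.
  rewrite lerBlDr; apply: ltW; apply: lt_le_trans tp _.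
  by rewrite -lerBlDl.
have lim i j : exists l, forall k, cnorm (l - u k i j) <= rho k.
  apply: (@cnorm_limit _ _ (fun k => u k i j)) => // k m km.
  apply: le_trans (uC k m km).
  by have := cnorm_entry (u m - u k) i j; rewrite !mxE.
pose z := \matrix_(i, j) projT1 (cid (lim i j)).
pose L : R := (n * n)%:R.
have zu k : snorm (z - u k) <= L * rho k.
  by apply: snorm_le => i j; rewrite !mxE; case: cid => l /=.
have L0 : 0 <= L by rewrite ler0n.
have zu_small e : 0 < e -> exists N, forall k, (N <= k)%N -> snorm (z - u k) <= e.
  move=> e0; have L1 : 0 < L + 1 by rewrite ltr_wpDl.
  have [N hN] := rho0 (e / (L + 1)) (divr_gt0 e0 L1).
  exists N => k /hN; rewrite ltr_pdivlMr // => h.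
  by apply: le_trans (zu k) _; have := rho_ge0 k; nra.
exists z; split; last first.
  move=> Q Qb QS Qc; apply: Qc => e /zu_small[N /(_ N (leqnn _)) h].
  by exists (u N); split=> //; elim: (N) => [|k] //=; exact: QS.
apply/eqP; rewrite -subr_eq0; apply/eqP.
apply: (@snorm_small _ _ _ _ _ (2 + snorm z + snorm z)) => e e0.
(* The bound 1 gives |u N| <= |z| + 1; the bound e then makes the defect at most e + e |z| + (|z| +
   1) e. *)
have [N hN] := zu_small (Num.min e 1) ltac:(by rewrite lt_min e0 ltr01).
have := hN N (leqnn N); have := hN N.+1 (leqnSn N).
rewrite !le_min => /andP[s1 _] /andP[s0 s01].
have -> : z - (b + z *m z) =
    (z - u N.+1) - ((z - u N) *m z + u N *m (z - u N)).
  rewrite mulmxBr mulmxBl addrA subrK /u /= -/u.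
  by rewrite !opprD opprK !addrA [RHS]addrAC subrK.
have sN : snorm (u N) <= snorm z + 1.
  have -> : u N = z - (z - u N) by rewrite opprB addrC subrK.
  by apply: le_trans (snormB _ _) _; rewrite lerD2l.
have := snormB (z - u N.+1) ((z - u N) *m z + u N *m (z - u N)).
have := snormD ((z - u N) *m z) (u N *m (z - u N)).
have := snormM (z - u N) z; have := snormM (u N) (z - u N).
have := snorm_ge0 z; have := snorm_ge0 (u N); have := snorm_ge0 (z - u N).
nra.
Qed.

End SquareRootIteration.

(** * Positive elements of a commutative C*-algebra *)

Section Positivity.
Variables (R : realType) (A : comCstarAlgType R).
Implicit Types (a b s x y : A) (t : R).

(** Positivity without spectra: square roots and the norm criteria below do the work of functional
    calculus. *)
Definition cpos a : Prop := exists2 s, star s = s & a = s * s.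

Lemma cpos_sa a : cpos a -> star a = a.
Proof. by case=> s s_sa ->; rewrite starM s_sa. Qed.

Lemma exists_sqrt x t : star x = x -> cnorm x <= t ->
  exists2 s, star s = s & s * s = rs t - x.
Proof.
move=> x_sa xt; have t_ge0 := le_trans (cnorm_ge0 x) xt.
have [t0|t_gt0] := leP t 0.
  have te : t = 0 by apply/eqP; rewrite eq_le t0.
  exists 0; first exact: star0.
  have -> : x = 0 by apply: cnorm_eq0; exact: le_trans xt t0.
  by rewrite te rmorph0 subr0 mul0r.
(* The matrix iteration is run in size 1. With b = x / (4t), the root is 2 sqrt(t) (1/2 - z), since
   4t (1/4 - b) = t - x. *)
pose b : 'M[A]_1 := const_mx (rs (4 * t)^-1 * x).
have n1 (z : 'M[A]_1) : snorm z = cnorm (z 0 0) by rewrite /snorm !big_ord1.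
have b4 : snorm b <= 1 / 4.
  rewrite n1 mxE cnorm_real ger0_norm ?invr_ge0 ?mulr_ge0 //.
  by rewrite mulrC ler_pdivrMr ?mulr_gt0 //; lra.
have [||||z [ez zQ]] := @sqrt_iter_limit R A 1 (fun c z => snorm z <= c) 1 b => //.
- by move=> c d x' y' _ _ h1 h2; apply: le_trans (snormD _ _) _; apply: lerD.
- move=> c d x' y' _ _ h1 h2; apply: le_trans (snormM _ _) _.
  by apply: ler_pM => //; exact: snorm_ge0.
- by move=> c x' _; rewrite mul1r.
have z_sa : star (z 0 0) = z 0 0.
  apply: (zQ (fun z => star (z 0 0) = z 0 0)).
  - by rewrite mxE starM x_sa star_rs mulrC.
  - by move=> w w_sa; rewrite !mxE big_ord1 starD !starM w_sa x_sa star_rs (mulrC x).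
  - move=> X hX; apply/eqP; rewrite -subr_eq0; apply/eqP; apply: cnorm_eq0.
    apply/ler_addgt0Pr => e e0; rewrite add0r.
    have [Y [Y_sa]] := hX (e / 2) (divr_gt0 e0 (ltr0n _ 2)).
    rewrite n1 !mxE => XY.
    apply: le_trans (ler_cnorm_trans (Y 0 0) _ _) _.
    by rewrite -{1}Y_sa -starB cnorm_star (cnormB (Y 0 0)); lra.
have ez0 : z 0 0 = rs (4 * t)^-1 * x + z 0 0 * z 0 0.
  by rewrite {1}ez !mxE big_ord1.
exists (rs (2 * Num.sqrt t) * (rs (1 / 2) - z 0 0)).
  by rewrite starM starB !star_rs z_sa mulrC.
set w := z 0 0 in ez0 *.
have -> : rs (2 * Num.sqrt t) * (rs (1 / 2) - w) *
    (rs (2 * Num.sqrt t) * (rs (1 / 2) - w)) =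
  rs (2 * Num.sqrt t * (2 * Num.sqrt t)) *
    (rs (1 / 2 * (1 / 2)) - (rs (1 / 2 + 1 / 2) * w - w * w)) by ring.
have -> : 2 * Num.sqrt t * (2 * Num.sqrt t) = 4 * t.
  by rewrite mulrACA -!expr2 sqr_sqrtr //; ring.
have -> : 1 / 2 + 1 / 2 = 1 :> R by field.
rewrite rmorph1 (mul1r w) {1}ez0 addrK mulrBr -rmorphM.
rewrite [X in _ - X]mulrA -rmorphM mulfV ?mulf_neq0 ?gt_eqF // rmorph1 (mul1r x).
by congr (rs _ - _); field.
Qed.

(* s + i y has square modulus t and real part s. *)
Lemma cnorm_sqr_le s y t : 0 <= t -> star s = s -> star y = y ->
  s * s + y * y = rs t -> cnorm (s * s) <= t.
Proof.
move=> t0 s_sa y_sa e.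
pose u := s + 'i *: y.
have su : star u = s - 'i *: y by rewrite /u starD starZ conj_i s_sa y_sa scaleNr.
have uu : star u * u = rs t.
  rewrite su -e /u -[_ *: y]mulr_algl; set j := _%:A.
  have jj : j * j = - 1 by rewrite /j mulr_algl scalerA mulii scaleN1r.
  by transitivity (s * s - (j * j) * (y * y)); [ring|rewrite jj; ring].
have u2 : cnorm u ^+ 2 = t by rewrite -cnorm_starM uu cnorm_rs ger0_norm.
have es : s = rs (1 / 2) * (star u + u).
  rewrite su addrACA addNr addr0 -[s in RHS]mul1r -mulrDl mulrA.
  by rewrite -(rmorph1 rs) -rmorphD -rmorphM mul1r mulVf ?rmorph1 ?mul1r.
rewrite cnorm_sqr // -u2 ler_pXn2r ?nnegrE ?cnorm_ge0 // {1}es cnorm_real.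
have := ler_cnormD (star u) u; rewrite cnorm_star ger0_norm ?divr_ge0 //; lra.
Qed.

Lemma cpos_rs t : 0 <= t -> cpos (rs t).
Proof.
by move=> t0; exists (rs (Num.sqrt t)); rewrite ?star_rs // -rmorphM -expr2 sqr_sqrtr.
Qed.

Lemma cpos0 : cpos 0.
Proof. by exists 0; rewrite ?star0 ?mulr0. Qed.

Lemma cposM a b : cpos a -> cpos b -> cpos (a * b).
Proof.
move=> [s s_sa ->] [y y_sa ->]; exists (s * y); last by ring.
by rewrite starM s_sa y_sa mulrC.
Qed.

(** Here t - a = y^2 and a = s^2, so y^2 + s^2 = t bounds y^2. With the converse [norm_cpos],
    positivity becomes a norm inequality. *)
Lemma cpos_norm a t : cpos a -> cnorm a <= t -> cnorm (rs t - a) <= t.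
Proof.
move=> a0 at_; have t0 := le_trans (cnorm_ge0 a) at_.
have [y y_sa e] := exists_sqrt (cpos_sa a0) at_; rewrite -e.
have [s s_sa ea] := a0.
by apply: (@cnorm_sqr_le y s) => //; rewrite e ea subrK.
Qed.

Lemma norm_cpos a t : star a = a -> cnorm (rs t - a) <= t -> cpos a.
Proof.
move=> a_sa /exists_sqrt[|s s_sa e]; first by rewrite starB star_rs a_sa.
by exists s; rewrite // e opprB addrC subrK.
Qed.

(** In the form |t - a| <= t, positivity is additive by the triangle inequality. *)
Lemma cposD a b : cpos a -> cpos b -> cpos (a + b).
Proof.
move=> a0 b0; apply: (@norm_cpos _ (cnorm a + cnorm b)).
  by rewrite starD !cpos_sa.
rewrite rmorphD opprD addrACA; apply: le_trans (ler_cnormD _ _) _.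
by apply: lerD; exact: cpos_norm.
Qed.

Lemma cpos_sum (I : Type) (r : seq I) (P : pred I) (F : I -> A) :
  (forall i, P i -> cpos (F i)) -> cpos (\sum_(i <- r | P i) F i).
Proof. by move=> F0; apply: big_ind => //; [exact: cpos0|exact: cposD]. Qed.

(* Real and imaginary parts commute, so |h + i k|^2 = h^2 + k^2. *)
Lemma cpos_starM x : cpos (star x * x).
Proof.
pose j : A := 'i%:A.
have jj : j * j = - 1 by rewrite /j mulr_algl scalerA mulii scaleN1r.
have sj : star j = - j by rewrite /j starZ conj_i star1 scaleNr.
pose c : A := rs (1 / 2).
pose h := c * (x + star x); pose k := c * (j * (star x - x)).
have -> : star x * x = h * h + k * k.
  have cc : (c + c) * (c + c) = 1.
    have -> : c + c = 1 by rewrite /c -rmorphD -(rmorph1 rs); congr (rs _); field.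
    by rewrite mulr1.
  rewrite -[LHS]mul1r -cc.
  transitivity (c * c * ((x + star x) * (x + star x) - (star x - x) * (star x - x))).
    by ring.
  transitivity (c * c * ((x + star x) * (x + star x) +
    (j * j) * (star x - x) * (star x - x))).
    by rewrite jj; ring.
  by rewrite /h /k; ring.
have c_sa : star c = c by exact: star_rs.
apply: cposD.
  by exists h; rewrite // /h starM c_sa starD starK mulrC [star x + x]addrC.
exists k; rewrite // /k starM starM c_sa sj starB starK; ring.
Qed.

Lemma cpos_anti a b : cpos a -> cpos b -> a + b = 0 -> a = 0.
Proof.
move=> [s s_sa ea] [y y_sa ->] e; apply: cnorm_eq0; rewrite ea.
by apply: (@cnorm_sqr_le s y) => //; rewrite -ea e rmorph0.
Qed.

Lemma cpos_le_norm a t : 0 <= t -> cpos a -> cpos (rs t - a) -> cnorm a <= t.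
Proof.
move=> t0 [s s_sa ea] [y y_sa e]; rewrite ea.
by apply: (@cnorm_sqr_le s y) => //; rewrite -e ea addrC subrK.
Qed.

Lemma starM_eq0 x : star x * x = 0 -> x = 0.
Proof.
move=> e; have := cnorm_starM x; rewrite e cnorm0 => /esym/eqP.
by rewrite expf_eq0 => /andP[_ /eqP] /cnorm0_eq0.
Qed.

Lemma cpos_sum_eq0 (I : finType) (F : I -> A) :
  (forall i, cpos (F i)) -> \sum_i F i = 0 -> forall i, F i = 0.
Proof.
move=> F0 e i; move: e; rewrite (bigD1 i) //=; apply: cpos_anti => //.
exact: cpos_sum.
Qed.

Lemma cpos_lim a b : star a = a -> (forall e, 0 < e -> cpos (a + rs e * b)) -> cpos a.
Proof.
move=> a_sa h; pose t := cnorm a + cnorm b.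
apply: (@norm_cpos a t) => //; apply/ler_addgt0Pr => e e0.
(* d <= 1 keeps |a + d b| below the fixed t, and d |b| <= e controls the error; adding 1 avoids a
   zero divisor. *)
pose d := Num.min 1 (e / (cnorm b + 1)).
have b1 : 0 < cnorm b + 1 by have := cnorm_ge0 b; lra.
have d0 : 0 < d by rewrite lt_min ltr01 divr_gt0.
have d1 : d <= 1 by rewrite ge_min lexx.
have de : d * cnorm b <= e.
  have : d <= e / (cnorm b + 1) by rewrite ge_min lexx orbT.
  by rewrite ler_pdivlMr //; nra.
have nd : cnorm (rs d * b) = d * cnorm b by rewrite cnorm_real gtr0_norm.
have b0 := cnorm_ge0 b.
have := @cpos_norm _ t (h d d0).
have -> : cnorm (a + rs d * b) <= t.
  by apply: le_trans (ler_cnormD _ _) _; rewrite nd /t; nra.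
move=> /(_ isT) h1.
have -> : rs t - a = (rs t - (a + rs d * b)) + rs d * b by ring.
apply: le_trans (ler_cnormD _ _) _; rewrite nd; lra.
Qed.

End Positivity.

(** * Matrices acting on the Hilbert module A^n *)

Section HilbertModule.
Variables (R : realType) (A : comCstarAlgType R).
Implicit Types (c d e r : R).

(** The rectangular form of [mxadj], so that it also applies to column vectors. *)
Definition hadj m n (M : 'M[A]_(m, n)) : 'M[A]_(n, m) := (map_mx star M)^T.

Lemma hadjE m n (M : 'M[A]_(m, n)) i j : hadj M i j = star (M j i).
Proof. by rewrite !mxE. Qed.

Lemma hadjK m n (M : 'M[A]_(m, n)) : hadj (hadj M) = M.
Proof. by apply/matrixP=> i j; rewrite !mxE starK. Qed.

Lemma hadjD m n (M N : 'M[A]_(m, n)) : hadj (M + N) = hadj M + hadj N.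
Proof. by apply/matrixP=> i j; rewrite !mxE starD. Qed.

Lemma hadjB m n (M N : 'M[A]_(m, n)) : hadj (M - N) = hadj M - hadj N.
Proof. by apply/matrixP=> i j; rewrite !mxE starB. Qed.

Lemma hadjZ m n r (M : 'M[A]_(m, n)) : hadj (rs r *: M) = rs r *: hadj M.
Proof. by apply/matrixP=> i j; rewrite !mxE starM star_rs mulrC. Qed.

Lemma hadjM m n p (M : 'M[A]_(m, n)) (N : 'M[A]_(n, p)) :
  hadj (M *m N) = hadj N *m hadj M.
Proof.
apply/matrixP=> i j; rewrite !mxE star_sum.
by apply: eq_bigr => k _; rewrite starM !hadjE.
Qed.

Lemma hadj_scalar n r : hadj ((rs r)%:M : 'M[A]_n) = (rs r)%:M.
Proof.
apply/matrixP=> i j; rewrite !mxE eq_sym.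
by case: eqP; rewrite /= ?mulr1n ?mulr0n ?star_rs ?star0.
Qed.

Lemma snorm_hadj m n (M : 'M[A]_(m, n)) : snorm (hadj M) = snorm M.
Proof.
rewrite /snorm exchange_big; apply: eq_bigr => i _; apply: eq_bigr => j _.
by rewrite hadjE cnorm_star.
Qed.

Definition ip n (v w : 'cV[A]_n) : A := (hadj v *m w) 0 0.
Definition sq n (v : 'cV[A]_n) : A := ip v v.

Lemma ip_hadj n (z : 'M[A]_n) (v w : 'cV[A]_n) : ip (z *m v) w = ip v (hadj z *m w).
Proof. by rewrite /ip hadjM mulmxA. Qed.

Lemma ipDr n (v w x : 'cV[A]_n) : ip v (w + x) = ip v w + ip v x.
Proof. by rewrite /ip mulmxDr mxE. Qed.

Lemma ipBr n (v w x : 'cV[A]_n) : ip v (w - x) = ip v w - ip v x.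
Proof. by rewrite /ip mulmxBr !mxE. Qed.

Lemma ipDl n (v w x : 'cV[A]_n) : ip (w + x) v = ip w v + ip x v.
Proof. by rewrite /ip hadjD mulmxDl mxE. Qed.

Lemma ipBl n (v w x : 'cV[A]_n) : ip (w - x) v = ip w v - ip x v.
Proof. by rewrite /ip hadjB mulmxBl !mxE. Qed.

Lemma ipZr n r (v w : 'cV[A]_n) : ip v (rs r *: w) = rs r * ip v w.
Proof. by rewrite /ip -scalemxAr mxE. Qed.

Lemma ipZl n r (v w : 'cV[A]_n) : ip (rs r *: v) w = rs r * ip v w.
Proof. by rewrite /ip hadjZ -scalemxAl mxE. Qed.

Lemma ip0r n (v : 'cV[A]_n) : ip v 0 = 0.
Proof. by rewrite /ip mulmx0 mxE. Qed.

Lemma sqE n (v : 'cV[A]_n) : sq v = \sum_i star (v i 0) * v i 0.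
Proof. by rewrite /sq /ip mxE; apply: eq_bigr => i _; rewrite hadjE. Qed.

Lemma sq_cpos n (v : 'cV[A]_n) : cpos (sq v).
Proof. by rewrite sqE; apply: cpos_sum => i _; exact: cpos_starM. Qed.

Lemma sq_eq0 n (v : 'cV[A]_n) : sq v = 0 -> v = 0.
Proof.
rewrite sqE => e; apply/matrixP=> i j; rewrite ord1 mxE; apply: starM_eq0.
by apply: (cpos_sum_eq0 _ e) => k; exact: cpos_starM.
Qed.

Lemma cposZ r (a : A) : 0 <= r -> cpos a -> cpos (rs r * a).
Proof. by move=> r0; apply: cposM; exact: cpos_rs. Qed.

Lemma cposZ_inv r (a : A) : 0 < r -> cpos (rs r * a) -> cpos a.
Proof.
move=> r0 /(@cposZ r^-1); rewrite mulrA -rmorphM mulVf ?gt_eqF // rmorph1 mul1r.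
by apply; rewrite invr_ge0 ltW.
Qed.

(** For c >= 0 this is the operator bound |z| <= c on the Hilbert module, stated in the order of
    A. *)
Definition contr n c (z : 'M[A]_n) : Prop :=
  forall v : 'cV[A]_n, cpos (rs (c ^+ 2) * sq v - sq (z *m v)).

Lemma contrW n c d (z : 'M[A]_n) : 0 <= c -> c <= d -> contr c z -> contr d z.
Proof.
move=> c0 cd zc v.
have -> : rs (d ^+ 2) * sq v - sq (z *m v) =
    rs (d ^+ 2 - c ^+ 2) * sq v + (rs (c ^+ 2) * sq v - sq (z *m v)) by ring.
apply: cposD => //; apply: cposZ (sq_cpos v).
by rewrite subr_ge0 ler_pXn2r ?nnegrE // (le_trans c0).
Qed.

(** A weighted parallelogram identity replaces Cauchy-Schwarz: after multiplication by c d, the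
    defect is a positive combination of the two given defects plus |d p - c q|^2. *)
Lemma contrD n c d (z w : 'M[A]_n) :
  0 < c -> 0 < d -> contr c z -> contr d w -> contr (c + d) (z + w).
Proof.
move=> c0 d0 zc wd v; apply: (@cposZ_inv (c * d)); first exact: mulr_gt0.
set p := z *m v; set q := w *m v.
have -> : rs (c * d) * (rs ((c + d) ^+ 2) * sq v - sq ((z + w) *m v)) =
   rs (d * (c + d)) * (rs (c ^+ 2) * sq v - sq p) +
   (rs (c * (c + d)) * (rs (d ^+ 2) * sq v - sq q) +
    sq (rs d *: p - rs c *: q)).
  rewrite mulmxDl -/p -/q /sq.
  by rewrite ipBl !ipBr ipDl !ipDr !ipZl !ipZr; ring.
have cd0 : 0 <= c + d by apply: addr_ge0; exact: ltW.
apply: cposD; first by apply: cposZ (zc v); rewrite mulr_ge0 // ltW.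
apply: cposD; first by apply: cposZ (wd v); rewrite mulr_ge0 // ltW.
exact: sq_cpos.
Qed.

Lemma contrM n c d (z w : 'M[A]_n) : contr c z -> contr d w -> contr (c * d) (z *m w).
Proof.
move=> zc wd v.
have -> : rs ((c * d) ^+ 2) * sq v - sq (z *m w *m v) =
    rs (c ^+ 2) * (rs (d ^+ 2) * sq v - sq (w *m v)) +
    (rs (c ^+ 2) * sq (w *m v) - sq (z *m (w *m v))).
  by rewrite -mulmxA; ring.
by apply: cposD (zc _); apply: cposZ (wd v); exact: sqr_ge0.
Qed.

Lemma contrZ n c r (z : 'M[A]_n) : contr c z -> contr (r * c) (rs r *: z).
Proof.
move=> zc v; rewrite -scalemxAl /sq ipZl ipZr.
have -> : rs ((r * c) ^+ 2) * ip v v - rs r * (rs r * ip (z *m v) (z *m v)) =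
  rs (r ^+ 2) * (rs (c ^+ 2) * sq v - sq (z *m v)) by rewrite /sq; ring.
by apply: cposZ (zc v); exact: sqr_ge0.
Qed.

(** Tested on the j-th basis vector, the bound controls the sum of squares down column j, hence each
    of its terms. *)
Lemma contr_entry n c (z : 'M[A]_n) i j : 0 <= c -> contr c z -> cnorm (z i j) <= c.
Proof.
move=> c0 /(_ (delta_mx j 0)) h.
rewrite -(@ler_pXn2r _ 2) ?nnegrE ?cnorm_ge0 // -cnorm_starM.
apply: cpos_le_norm; [exact: sqr_ge0|exact: cpos_starM|].
have -> : rs (c ^+ 2) - star (z i j) * z i j =
    (rs (c ^+ 2) - sq (col j z)) + (sq (col j z) - star (z i j) * z i j) by ring.
apply: cposD.
  suff : sq (delta_mx j 0 : 'cV[A]_n) = 1 by move=> e; move: h; rewrite e mulr1 -colE.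
  rewrite sqE (bigD1 j) //= big1 => [|k /negPf kj]; rewrite !mxE ?eqxx ?kj /=.
    by rewrite star1 mulr1 addr0.
  by rewrite mulr0.
rewrite sqE (bigD1 i) //= !mxE addrAC subrr add0r.
by apply: cpos_sum => k _; exact: cpos_starM.
Qed.

Lemma contr_snorm n c (z : 'M[A]_n) : 0 <= c -> contr c z -> snorm z <= (n * n)%:R * c.
Proof. by move=> c0 zc; apply: snorm_le => i j; exact: contr_entry. Qed.

Lemma contr_elementary n (a : A) (i j : 'I_n) :
  contr (cnorm a) (a *: delta_mx i j).
Proof.
move=> v.
have -> : sq (a *: delta_mx i j *m v) = star a * a * (star (v j 0) * v j 0).
  have E k : (a *: delta_mx i j *m v) k 0 = (k == i)%:R * (a * v j 0).
    rewrite mxE (bigD1 j) //= big1 => [|l /negPf lj]; rewrite !mxE ?eqxx ?lj /=.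
      by rewrite addr0 andbT -mulrA mulrCA.
    by rewrite andbF mulr0 mul0r.
  rewrite sqE (bigD1 i) //= big1 => [|k /negPf ki]; rewrite E ?eqxx ?ki.
    by rewrite mul1r starM; ring.
  by rewrite mul0r mulr0.
rewrite sqE (bigD1 j) //=; set b := star (v j 0) * _; set s := \sum_(_ < _ | _) _.
have -> : rs (cnorm a ^+ 2) * (b + s) - star a * a * b =
  (rs (cnorm a ^+ 2) - star a * a) * b + rs (cnorm a ^+ 2) * s by ring.
apply: cposD.
  apply: cposM; last exact: cpos_starM.
  apply: (@norm_cpos _ _ _ (cnorm a ^+ 2)).
    by rewrite starB star_rs starM starK.
  by rewrite opprB addrC subrK cnorm_starM.
apply: cposZ; first exact: sqr_ge0.
by apply: cpos_sum => k _; exact: cpos_starM.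
Qed.

(** z is a sum of one-entry matrices. The slack e is there because [contrD] asks for strictly
    positive bounds and entries may vanish. *)
Lemma snorm_contr n (z : 'M[A]_n) e : 0 < e -> contr (snorm z + e) z.
Proof.
move: e; pose K c (x : 'M[A]_n) := 0 <= c /\ forall e, 0 < e -> contr (c + e) x.
suff : K (snorm z) z by case.
have KD c d x y : K c x -> K d y -> K (c + d) (x + y).
  move=> [c0 xc] [d0 yd]; split; first exact: addr_ge0.
  move=> e e0; have e2 : 0 < e / 2 by exact: divr_gt0.
  have -> : c + d + e = (c + e / 2) + (d + e / 2) by field.
  by apply: contrD; [lra|lra|exact: xc|exact: yd].
have K0 : K 0 0.
  split=> // e _ v; rewrite mul0mx.
  have -> : sq (0 : 'cV[A]_n) = 0 by exact: ip0r.
  by rewrite subr0; apply: cposZ (sq_cpos v); exact: sqr_ge0.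
rewrite [X in K _ X]matrix_sum_delta /snorm.
apply: (@big_ind2 _ _ K) => [//|? ? ? ?|i _]; first exact: KD.
apply: (@big_ind2 _ _ K) => [//|? ? ? ?|j _]; first exact: KD.
split.
  exact: cnorm_ge0.
move=> e e0; apply: contrW (contr_elementary _ i j); first exact: cnorm_ge0.
by rewrite lerDl ltW.
Qed.

Lemma contr_closed n c : 0 < c -> snorm_closed (@contr n c).
Proof.
move=> c0 X hX v; apply: (@cpos_lim _ _ _ (sq v)).
  by rewrite starB starM star_rs (cpos_sa (sq_cpos v)) (cpos_sa (sq_cpos _)) mulrC.
move=> e e0.
(* Chosen so that (c + 2d)^2 = c^2 + e: one d bounds |X - Y|, the other is the slack of
   [snorm_contr]. *)
pose d := (Num.sqrt (c ^+ 2 + e) - c) / 2.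
have ce : 0 <= c ^+ 2 + e by rewrite addr_ge0 ?sqr_ge0 // ltW.
have d0 : 0 < d.
  rewrite divr_gt0 // subr_gt0 -[ltLHS]gtr0_norm // -sqrtr_sqr.
  by rewrite ltr_sqrt ?ltrDl // ltr_pwDr ?sqr_ge0.
have [Y [Yc XY]] := hX d d0.
have : contr (c + (d + d)) (Y + (X - Y)).
  apply: contrD => //; first exact: addr_gt0.
  apply: contrW (@snorm_contr _ (X - Y) d d0); last by rewrite lerD2r.
  by rewrite addr_ge0 ?snorm_ge0 // ltW.
have -> : c + (d + d) = Num.sqrt (c ^+ 2 + e) by rewrite /d; field.
rewrite (addrC Y) subrK => /(_ v); rewrite sqr_sqrtr // rmorphD mulrDl.
by rewrite addrAC.
Qed.

End HilbertModule.

(** * Square roots of positive matrices *)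

Section PositiveSquareRoot.
Variables (R : realType) (A : comCstarAlgType R) (n : nat).
Implicit Types (x y z : 'M[A]_n) (v w : 'cV[A]_n).

Definition closed_subalgebra (Q : 'M[A]_n -> Prop) : Prop :=
  [/\ Q 1%:M, forall (r : R) x, Q x -> Q (rs r *: x),
      forall x y, Q x -> Q y -> Q (x + y),
      forall x y, Q x -> Q y -> Q (x *m y) & snorm_closed Q].

Lemma selfadjoint_closed : snorm_closed (fun z : 'M[A]_n => hadj z = z).
Proof.
move=> X hX; apply/eqP; rewrite -subr_eq0; apply/eqP.
apply: (@snorm_small _ _ _ _ _ 2) => e e0; have [Y [Ysa XY]] := hX e e0.
have -> : hadj X - X = hadj (X - Y) - (X - Y) by rewrite hadjB Ysa opprB addrA subrK.
by apply: le_trans (snormB _ _) _; rewrite snorm_hadj; lra.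
Qed.

Lemma commutant_closed y : snorm_closed (fun z => z *m y = y *m z).
Proof.
move=> X hX; apply/eqP; rewrite -subr_eq0; apply/eqP.
apply: (@snorm_small _ _ _ _ _ (2 * snorm y)) => e e0; have [Y [Yc XY]] := hX e e0.
have -> : X *m y - y *m X = (X - Y) *m y - y *m (X - Y).
  by rewrite mulmxBl mulmxBr Yc opprB addrA subrK.
apply: le_trans (snormB _ _) _.
have := snormM (X - Y) y; have := snormM y (X - Y).
have := snorm_ge0 y; have := snorm_ge0 (X - Y); nra.
Qed.

Let half : 'M[A]_n := rs (1 / 2) *: 1%:M.

Lemma half_sub_sqr b z : z = b + z *m z ->
  (half - z) *m (half - z) = rs (1 / 4) *: 1%:M - b.
Proof.
move=> ez.
have hh : half *m half = rs (1 / 4) *: 1%:M.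
  rewrite /half -scalemxAl mul1mx scalerA -rmorphM.
  by congr (rs _ *: _); field.
have hz : half *m z + z *m half = z.
  rewrite /half -scalemxAl -scalemxAr mul1mx mulmx1 -scalerDl -rmorphD.
  have -> : 1 / 2 + 1 / 2 = 1 :> R by field.
  by rewrite rmorph1 scale1r.
rewrite mulmxBl !mulmxBr opprB [z *m z - _]addrC addrA -(addrA (half *m half)).
by rewrite -opprD hz hh {1}ez opprD addrA subrK.
Qed.

Let contr_sqr x c : contr c x -> contr (c ^+ 2) (x *m x).
Proof. by move=> xc; rewrite expr2; exact: contrM. Qed.

(** The bound 1/2 is invariant under the iteration, as 1/4 + (1/2)^2 = 1/2. *)
Lemma contr_sqrt b : hadj b = b -> contr (1 / 4) b ->
  exists z, [/\ z = b + z *m z, hadj z = z, contr (1 / 2) z &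
    forall Q, Q b -> (forall x, Q x -> Q (b + x *m x)) -> snorm_closed Q -> Q z].
Proof.
move=> b_sa bc.
have c2 : 0 < 1 / 2 :> R by exact: divr_gt0.
have [||| |z [ez zQ]] := @sqrt_iter_limit R A n (@contr R A n) (n * n)%:R b => //.
- by move=> c d x y; exact: contrD.
- by move=> c d x y _ _; exact: contrM.
- by move=> c x c0; exact: contr_snorm (ltW c0).
exists z; split=> //.
  apply: (zQ (fun z => hadj z = z)) => //; last exact: selfadjoint_closed.
  by move=> x x_sa; rewrite hadjD hadjM x_sa b_sa.
apply: zQ; last exact: contr_closed.
  by apply: contrW bc; lra.
move=> x /contr_sqr xc.
have -> : 1 / 2 = 1 / 4 + (1 / 2) ^+ 2 :> R by field.
have c4 : 0 < 1 / 4 :> R by exact: divr_gt0.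
by apply: contrD => //; exact: exprn_gt0.
Qed.

Lemma contr_exists x : exists2 c, 0 < c & contr c x.
Proof.
by exists (snorm x + 1); [rewrite ltr_wpDl ?snorm_ge0|exact: snorm_contr].
Qed.

(** The iteration asks for norm bounds rather than positivity. So M is rescaled to H, and |H| is
    built as G1 through G0^2 = 1/4 - H^2 and G1^2 = 1/4 - G0^2. A further root gives G2^2 = G1/2,
    and positivity of M enters only to show G1 = H. *)
Lemma psd_sqrt (M : 'M[A]_n) (Q : 'M[A]_n -> Prop) :
  hadj M = M -> (forall v, cpos (ip v (M *m v))) -> closed_subalgebra Q -> Q M ->
  exists S, [/\ Q S, hadj S = S & M = S *m S].
Proof.
move=> M_sa M_pos [Q1 QZ QD QM Qc] QMM.
have [c c0 Mc] := contr_exists M.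
have QN x : Q x -> Q (- x) by move=> /(QZ (-1)); rewrite rmorphN1 scaleN1r.
have Qhalf : Q half by exact: QZ.
have half_sa : hadj half = half by rewrite /half scalemx1 hadj_scalar.
have Qlim b z : Q b ->
    (forall Q, Q b -> (forall x, Q x -> Q (b + x *m x)) -> snorm_closed Q -> Q z) -> Q z.
  by move=> Qb; apply=> // x Qx; apply: QD => //; exact: QM.
pose r := (1 / 2) / c; have r0 : 0 < r by rewrite !divr_gt0.
have [H HE] : exists H, H = rs r *: M by eexists.
have QH : Q H by rewrite HE; exact: QZ.
have H_sa : hadj H = H by rewrite HE hadjZ M_sa.
have Hc : contr (1 / 2) H.
  have -> : 1 / 2 = r * c by rewrite mulfVK // gt_eqF.
  by rewrite HE; exact: contrZ.
have HHc : contr (1 / 4) (H *m H).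
  have -> : 1 / 4 = (1 / 2) ^+ 2 :> R by field.
  exact: contr_sqr.
have HH_sa : hadj (H *m H) = H *m H by rewrite hadjM H_sa.
have [z0 [e0 z0_sa z0c z0Q]] := contr_sqrt HH_sa HHc.
pose G0 := half - z0.
have G0G0 : G0 *m G0 = rs (1 / 4) *: 1%:M - H *m H by exact: half_sub_sqr.
have G0_sa : hadj G0 = G0 by rewrite hadjB half_sa z0_sa.
have QG0 : Q G0 by apply: QD => //; apply: QN; apply: Qlim z0Q; exact: QM.
(* |G0 v|^2 = |v|^2 / 4 - |H v|^2, so the bound comes from the defining identity. *)
have G0c : contr (1 / 2) G0.
  move=> v; rewrite /sq ip_hadj G0_sa mulmxA G0G0.
  rewrite mulmxBl -scalemxAl mul1mx ipBr ipZr -mulmxA -{1}H_sa -ip_hadj -/(sq (H *m v)).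
  have -> : (1 / 2) ^+ 2 = 1 / 4 :> R by field.
  by rewrite opprB addrC subrK; exact: sq_cpos.
clearbody G0.
have GGc : contr (1 / 4) (G0 *m G0).
  have -> : 1 / 4 = (1 / 2) ^+ 2 :> R by field.
  exact: contr_sqr.
have GG_sa : hadj (G0 *m G0) = G0 *m G0 by rewrite hadjM G0_sa.
have [z1 [e1 z1_sa z1c z1Q]] := contr_sqrt GG_sa GGc.
pose G1 := half - z1.
have G1G1 : G1 *m G1 = H *m H by rewrite (half_sub_sqr e1) G0G0 opprB addrC subrK.
have G1_sa : hadj G1 = G1 by rewrite hadjB half_sa z1_sa.
(* G1 is a limit of polynomials in G0^2, which commutes with H, and commutants are closed. *)
have G1H : G1 *m H = H *m G1.
  have GGH : G0 *m G0 *m H = H *m (G0 *m G0).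
    by rewrite G0G0 mulmxBl mulmxBr -scalemxAl -scalemxAr mul1mx mulmx1 mulmxA.
  rewrite /G1 mulmxBl mulmxBr /half -scalemxAl -scalemxAr mul1mx mulmx1.
  congr (_ - _).
  apply: (z1Q (fun z => z *m H = H *m z)) => //; last exact: commutant_closed.
  by move=> x xH; rewrite mulmxDl mulmxDr GGH -(mulmxA x) xH (mulmxA x) xH -(mulmxA H).
have Qz1 : Q z1 by apply: Qlim z1Q; exact: QM.
(* 1/4 - z1/2 = (1/2 - z1)/2 = G1/2, and the bound 1/2 on z1 gives the required 1/4. *)
pose b2 : 'M[A]_n := rs (1 / 2) *: z1.
have b2_sa : hadj b2 = b2 by rewrite hadjZ z1_sa.
have b2c : contr (1 / 4) b2.
  have -> : 1 / 4 = 1 / 2 * (1 / 2) :> R by field.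
  exact: contrZ.
have [z2 [e2 z2_sa _ z2Q]] := contr_sqrt b2_sa b2c.
pose G2 := half - z2.
have G2G2 : G2 *m G2 = rs (1 / 2) *: G1.
  rewrite (half_sub_sqr e2) /b2 /G1 /half scalerBr scalerA -rmorphM.
  by congr (rs _ *: _ - _); field.
have G2_sa : hadj G2 = G2 by rewrite hadjB half_sa z2_sa.
have QG2 : Q G2 by apply: QD => //; apply: QN; apply: Qlim z2Q; exact: QZ.
clearbody G1 G2.
have G12 w : G1 *m w = rs 2 *: (G2 *m (G2 *m w)).
  rewrite mulmxA G2G2 -scalemxAl scalerA -rmorphM.
  have -> : 2 * (1 / 2) = 1 :> R by field.
  by rewrite rmorph1 scale1r.
(* For w = (G1 - H) v the two positive terms <w, G1 w> and <w, H w> add up to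
   zero, because G1^2 = H^2. *)
have vanish v : (G1 - H) *m v = 0.
  set w := (G1 - H) *m v.
  have G1w : G1 *m w = - (H *m w).
    apply/eqP; rewrite -addr_eq0 -mulmxDl /w mulmxA.
    by rewrite mulmxDl !mulmxBr G1G1 G1H addrA subrK subrr mul0mx.
  have e : sq (G2 *m w) *+ 2 + rs r * ip w (M *m w) = 0.
    have -> : sq (G2 *m w) *+ 2 = ip w (G1 *m w).
      by rewrite G12 ipZr /sq ip_hadj G2_sa rmorphMn rmorph1 mulr_natl.
    by rewrite -ipZr scalemxAl -HE -ipDr G1w addNr ip0r.
  have G2w : G2 *m w = 0.
    apply: sq_eq0; have := cpos_anti _ _ e.
    have h2 : cpos (sq (G2 *m w) *+ 2) by apply: cposD; exact: sq_cpos.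
    move=> /(_ h2 (cposZ (ltW r0) (M_pos w))) => s2.
    by apply: (cpos_anti (sq_cpos _) (sq_cpos (G2 *m w))); rewrite -mulr2n.
  have G1w0 : G1 *m w = 0 by rewrite G12 G2w mulmx0 scaler0.
  have Hw0 : H *m w = 0 by apply: oppr_inj; rewrite -G1w oppr0.
  apply: sq_eq0; rewrite /sq {1}/w ip_hadj hadjB G1_sa H_sa mulmxBl G1w0 Hw0.
  by rewrite subrr ip0r.
have G1e : G1 = H.
  apply/eqP; rewrite -subr_eq0; apply/eqP/matrixP=> i j.
  have /matrixP/(_ i 0) := vanish (delta_mx j 0).
  by rewrite -colE !mxE.
(* G2^2 = H/2 = r M/2, hence the factor 2/r. *)
exists (rs (Num.sqrt (2 / r)) *: G2); split.
- exact: QZ.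
- by rewrite hadjZ G2_sa.
rewrite -scalemxAl -scalemxAr scalerA -rmorphM -expr2 sqr_sqrtr; last first.
  by rewrite divr_ge0 // ltW.
rewrite G2G2 G1e HE !scalerA -!rmorphM.
have -> : 2 / r * (1 / 2 * r) = 1 by field; rewrite gt_eqF.
by rewrite rmorph1 scale1r.
Qed.

End PositiveSquareRoot.

(** * Averages over a finite group action *)

Section StarHomomorphisms.
Variables (R : realType) (B D : starAlgType R) (S : set B) (f : B -> D).
Hypotheses (S_sub : linear_subspace S) (f_hom : star_hom_on S f).

Lemma hom_on0 : f 0 = 0.
Proof.
have [S0 _] := S_sub; have [/(_ 1 0 0 S0 S0) h _ _ _] := f_hom.
by move: h; rewrite !scale1r addr0 => /(congr1 (fun z => z - f 0)); rewrite subrr addrK.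
Qed.

Lemma hom_onD x y : S x -> S y -> f (x + y) = f x + f y.
Proof.
by have [h _ _ _] := f_hom => Sx Sy; rewrite -{1}(scale1r x) h // scale1r.
Qed.

Lemma hom_onZ a x : S x -> f (a *: x) = a *: f x.
Proof.
have [S0 _] := S_sub; have [h _ _ _] := f_hom => Sx.
by rewrite -{1}(addr0 (a *: x)) h // hom_on0 addr0.
Qed.

(** f is additive only on S, so the induction carries membership of the partial sums. *)
Lemma hom_on_sum (I : finType) (F : I -> B) :
  (forall i, S (F i)) -> f (\sum_i F i) = \sum_i f (F i).
Proof.
move=> SF; have [S0 Slin] := S_sub.
suff [_] : S (\sum_i F i) /\ f (\sum_i F i) = \sum_i f (F i) by [].
apply: (big_ind2 (fun x y => S x /\ f x = y)) => //.
  by split=> //; exact: hom_on0.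
move=> x1 x2 y1 y2 [Sx <-] [Sy <-]; split; last exact: hom_onD.
by rewrite -(scale1r x1); exact: Slin.
Qed.

End StarHomomorphisms.

Section Homs.
Variables (R : realType) (B D : starAlgType R) (f : B -> D).
Hypothesis f_hom : star_hom_on [set: B] f.

Let T_sub : linear_subspace [set: B]. Proof. by split. Qed.

Lemma hom0 : f 0 = 0. Proof. exact: hom_on0 T_sub f_hom. Qed.

Lemma homD x y : f (x + y) = f x + f y.
Proof. exact: (hom_onD f_hom). Qed.

Lemma homZ a x : f (a *: x) = a *: f x.
Proof. exact: (hom_onZ T_sub f_hom). Qed.

Lemma homB x y : f (x - y) = f x - f y.
Proof. by rewrite homD -scaleN1r homZ scaleN1r. Qed.

Lemma homM x y : f (x * y) = f x * f y.
Proof. by have [_ _ h _] := f_hom; exact: h. Qed.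

Lemma hom1 : f 1 = 1. Proof. by have [_ h _ _] := f_hom. Qed.

Lemma hom_star x : f (star x) = star (f x).
Proof. by have [_ _ _ h] := f_hom; exact: h. Qed.

Lemma hom_rs r : f (rs r) = rs r.
Proof. by rewrite /rs homZ hom1. Qed.

Lemma hom_sum (I : finType) (F : I -> B) : f (\sum_i F i) = \sum_i f (F i).
Proof. exact: (hom_on_sum T_sub f_hom). Qed.

End Homs.

Section Average.
Variables (R : realType) (T : starAlgType R) (gT : finGroupType).
Variable beta : gT -> T -> T.
Hypotheses (beta_hom : forall g, star_hom_on [set: T] (beta g))
           (betaM : forall g h x, beta (g * h)%g x = beta g (beta h x)).

(** The canonical conditional expectation onto the fixed-point algebra. *)
Definition avg (x : T) : T := rs (#|gT|%:R)^-1 * \sum_g beta g x.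

Lemma card_group_neq0 : #|gT|%:R != 0 :> R.
Proof. by rewrite pnatr_eq0 -lt0n; apply/card_gt0P; exists 1%g. Qed.

Lemma avg_fixed x : fixed_points beta (avg x).
Proof.
move=> h; rewrite /avg homM // hom_rs // hom_sum //; congr (_ * _).
rewrite [RHS](reindex_inj (mulgI h)) /=.
by apply: eq_bigr => g _; rewrite betaM.
Qed.

Lemma avgMl c x : fixed_points beta c -> avg (c * x) = c * avg x.
Proof.
move=> cF; rewrite /avg mulrA -rs_comm -mulrA; congr (_ * _).
by rewrite mulr_sumr; apply: eq_bigr => g _; rewrite homM // cF.
Qed.

Lemma avg1 : avg 1 = 1.
Proof.
rewrite /avg (eq_bigr (fun _ => 1)) => [|g _]; last exact: hom1.
rewrite sumr_const -(rmorph1 rs) -rmorphMn -rmorphM; congr (rs _).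
by rewrite -[#|_|]/(#|gT|) mulVf // card_group_neq0.
Qed.

Lemma avg_id c : fixed_points beta c -> avg c = c.
Proof. by move=> cF; rewrite -{1}(mulr1 c) avgMl // avg1 mulr1. Qed.

Lemma avg_linear a x y : avg (a *: x + y) = a *: avg x + avg y.
Proof.
rewrite /avg scalerAr -mulrDr scaler_sumr -big_split; congr (_ * _).
by apply: eq_bigr => g _; rewrite homD // homZ.
Qed.

Lemma avgB x y : avg (x - y) = avg x - avg y.
Proof. by rewrite addrC -scaleN1r avg_linear scaleN1r addrC. Qed.

Lemma avg_star x : avg (star x) = star (avg x).
Proof.
rewrite /avg starM star_rs -rs_comm star_sum; congr (_ * _).
by apply: eq_bigr => g _; rewrite hom_star.
Qed.

Lemma fixed_points_subspace : linear_subspace (fixed_points beta).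
Proof.
split=> [g|a x y xF yF g]; first exact: hom0.
by rewrite homD // homZ // xF yF.
Qed.

End Average.

(** * Non-constant weights from a non-trivial action *)

Section Automorphisms.
Variables (R : realType) (A : comCstarAlgType R).

(** The image under f of a square root of |x* x| - x* x witnesses that f(x)* f(x) is at most |x*
    x|. *)
Lemma hom_contractive (f : A -> A) x :
  star_hom_on [set: A] f -> cnorm (f x) <= cnorm x.
Proof.
move=> f_hom; rewrite -(@ler_pXn2r _ 2) ?nnegrE ?cnorm_ge0 // -!cnorm_starM.
have x_sa : star (star x * x) = star x * x by rewrite starM starK.
have [s s_sa es] := exists_sqrt x_sa (lexx _).
apply: cpos_le_norm; [exact: cnorm_ge0|exact: cpos_starM|].
exists (f s); first by rewrite -hom_star // s_sa.
by rewrite -homM // es homB // hom_rs // homM // hom_star.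
Qed.

Variables (gT : finGroupType) (alpha : gT -> A -> A).
Hypotheses (alpha_act : star_action alpha) (alpha_nt : exists g, alpha g <> id).

Lemma action_hom g : star_hom_on [set: A] (alpha g).
Proof. by have [/(_ g)[]] := alpha_act. Qed.

Lemma action_mulg g h x : alpha (g * h)%g x = alpha g (alpha h x).
Proof. by have [_ ->] := alpha_act. Qed.

Lemma action1 x : alpha 1%g x = x.
Proof.
have [/(_ 1%g)[_ /bij_inj inj] _] := alpha_act.
by apply: inj; rewrite -action_mulg mulg1.
Qed.

Let E := avg alpha.

Lemma selfadjoint_moved : exists g (a : A), star a = a /\ alpha g a <> a.
Proof.
have [g gN] := alpha_nt.
have /existsNP[a aN] : ~ forall a, alpha g a = a by move=> h; apply: gN; exact/funext.
have hg := action_hom g; exists g.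
apply: contrapT => /forallNP N.
have fix_sa b : star b = b -> alpha g b = b.
  by move=> b_sa; apply: contrapT => bN; exact: (N b).
have h1 : alpha g (a + star a) = a + star a.
  by apply: fix_sa; rewrite starD starK addrC.
have h2 : alpha g ('i *: (a - star a)) = 'i *: (a - star a).
  by apply: fix_sa; rewrite starZ conj_i starB starK scaleNr -scalerN opprB.
have h3 : alpha g (a - star a) = a - star a.
  move: h2; rewrite homZ // => /(congr1 (fun z => (- 'i) *: z)).
  by rewrite !scalerA mulNr mulii opprK !scale1r.
apply: aN.
have e (x y : A) : x = rs (1 / 2) * ((x + y) + (x - y)).
  transitivity (rs (1 / 2 + 1 / 2) * x); last by ring.
  have -> : 1 / 2 + 1 / 2 = 1 :> R by field.
  by rewrite rmorph1 mul1r.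
rewrite [in LHS](e a (star a)) homM // hom_rs // homD // h1 h3 -e.
by [].
Qed.

(* k^2 is a density with mean 1 other than the constant 1. *)
Lemma exists_weight :
  exists k : A, [/\ star k = k, E (k * k) = 1 & E (k * k * (k * k)) <> 1].
Proof.
have [g [a [a_sa aN]]] := selfadjoint_moved.
have ah := action_hom; have fixE := avg_fixed ah action_mulg.
pose b := a - E a.
have b_sa : star b = b by rewrite starB -(avg_star ah) a_sa.
have Eb : E b = 0 by rewrite /b /E (avgB ah) (avg_id ah (fixE a)) subrr.
have b0 : cnorm b != 0.
  apply/eqP => /cnorm0_eq0/eqP; rewrite subr_eq0 => /eqP e; apply: aN; rewrite e.
  exact: fixE.
pose h := rs (cnorm b)^-1 * b.
have h_sa : star h = h by rewrite starM star_rs b_sa mulrC.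
have h1 : cnorm h = 1.
  by rewrite cnorm_real ger0_norm ?invr_ge0 ?cnorm_ge0 // mulVf.
have Eh : E h = 0.
  by rewrite /E /h (avgMl ah) => [|l]; [rewrite -/E Eb mulr0|exact: hom_rs].
have [k k_sa] := exists_sqrt h_sa (lexx _); rewrite h1 rmorph1 => kk.
exists k; split=> //; rewrite kk.
  by rewrite /E (avgB ah) (avg1 ah) -/E Eh subr0.
(* The average of k^4 = (1 - h)^2 is 1 + E(h^2). Were it 1, the positive elements alpha_g(h^2) would
   sum to 0, so h^2, the term at the identity, would vanish. *)
have -> : (1 - h) * (1 - h) = 1 - h - (h - h * h) by ring.
rewrite /E !(avgB ah) (avg1 ah) -/E Eh.
rewrite subr0 sub0r opprK => /(congr1 (fun z => z - 1)); rewrite subrr addrC addKr.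
move=> /(congr1 (fun z => rs #|gT|%:R * z)); rewrite mulr0 mulrA -rmorphM.
rewrite mulfV ?card_group_neq0 // rmorph1 mul1r => Shh.
have hh0 : alpha 1%g (h * h) = 0.
  apply: (cpos_sum_eq0 _ Shh) => l.
  exists (alpha l h); last exact: homM.
  by rewrite -(hom_star (ah l)) h_sa.
have h0 : h = 0 by apply: starM_eq0; rewrite h_sa -hh0 action1.
by move: h1; rewrite h0 cnorm0 => /esym/eqP; rewrite oner_eq0.
Qed.

End Automorphisms.

(** * Weighted averages on an algebra isomorphic to M_m(A) *)

Section MatrixModel.
Variables (R : realType) (A : comCstarAlgType R) (gT : finGroupType).
Variables (T : starAlgType R) (m : nat) (e : T -> 'M[A]_m) (e' : 'M[A]_m -> T).
Variable beta : gT -> T -> T.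
Hypotheses (eK : cancel e e') (e'K : cancel e' e)
  (eD : {morph e : x y / x + y}) (eZ : forall r x, e (rs r * x) = rs r *: e x)
  (eM : forall x y, e (x * y) = e x *m e y) (e1 : e 1 = 1%:M)
  (e_star : forall x, e (star x) = hadj (e x)).
Hypotheses (beta_hom : forall g, star_hom_on [set: T] (beta g))
  (betaM : forall g h x, beta (g * h)%g x = beta g (beta h x))
  (beta_le : forall g x c, (forall i j, cnorm (e x i j) <= c) ->
     forall i j, cnorm (e (beta g x) i j) <= c).

Let e0 : e 0 = 0.
Proof. by apply: (addrI (e 0)); rewrite -eD !addr0. Qed.

Let eN x : e (- x) = - e x.
Proof. by apply: (addrI (e x)); rewrite -eD !subrr e0. Qed.

Let e_sum (I : finType) (F : I -> T) : e (\sum_i F i) = \sum_i e (F i).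
Proof. exact: (big_morph e eD e0). Qed.

Section Flatten.
Variable n : nat.
Local Notation N := #|{: 'I_n * 'I_m}|.
Implicit Types X Y : 'M[T]_n.

(** Since e identifies T with M_m(A), this identifies M_n(T) with matrices over A indexed by pairs,
    where [psd_sqrt] applies. *)
Definition flatten_mx X : 'M[A]_N :=
  \matrix_(p, q) e (X (enum_val p).1 (enum_val q).1) (enum_val p).2 (enum_val q).2.

Lemma flatten_mx_rank X i a l b :
  flatten_mx X (enum_rank (i, a)) (enum_rank (l, b)) = e (X i l) a b.
Proof. by rewrite mxE !enum_rankK. Qed.

Lemma flatten_mx_inj : injective flatten_mx.
Proof.
move=> X Y XY; apply/matrixP=> i l; apply: (can_inj eK); apply/matrixP=> a b.
by rewrite -!flatten_mx_rank XY.
Qed.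

Lemma flatten_mx_surj (Z : 'M[A]_N) : exists X, flatten_mx X = Z.
Proof.
exists (\matrix_(i, l) e' (\matrix_(a, b) Z (enum_rank (i, a)) (enum_rank (l, b)))).
apply/matrixP=> p q; rewrite !mxE e'K mxE -!surjective_pairing.
by rewrite !enum_valK.
Qed.

Lemma flatten_mxD X Y : flatten_mx (X + Y) = flatten_mx X + flatten_mx Y.
Proof. by apply/matrixP=> p q; rewrite !mxE eD mxE. Qed.

Lemma flatten_mxB X Y : flatten_mx (X - Y) = flatten_mx X - flatten_mx Y.
Proof. by apply/matrixP=> p q; rewrite !mxE eD eN !mxE. Qed.

Lemma flatten_mxZ r X :
  flatten_mx (map_mx (fun x => rs r * x) X) = rs r *: flatten_mx X.
Proof. by apply/matrixP=> p q; rewrite !mxE eZ mxE. Qed.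

Lemma flatten_mx1 : flatten_mx 1%:M = 1%:M.
Proof.
apply/matrixP=> p q; rewrite !mxE -(inj_eq enum_val_inj).
case: (enum_val p) => i a; case: (enum_val q) => l b /=; rewrite xpair_eqE.
by case: (i == l); rewrite ?mulr1n ?mulr0n ?e1 ?e0 mxE.
Qed.

Lemma flatten_mxM X Y : flatten_mx (X *m Y) = flatten_mx X *m flatten_mx Y.
Proof.
apply/matrixP=> p q; rewrite !mxE e_sum summxE.
transitivity (\sum_i \sum_a
    e (X (enum_val p).1 i) (enum_val p).2 a * e (Y i (enum_val q).1) a (enum_val q).2).
  by apply: eq_bigr => i _; rewrite eM mxE.
rewrite pair_bigA (reindex _ (onW_bij _ (@enum_val_bij _))) /=.
by apply: eq_bigr => s _; rewrite !mxE.
Qed.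

Lemma flatten_mx_hadj X : flatten_mx (mxadj X) = hadj (flatten_mx X).
Proof. by apply/matrixP=> p q; rewrite !mxE e_star hadjE. Qed.

Lemma flatten_mx_sum (I : finType) (F : I -> 'M[T]_n) :
  flatten_mx (\sum_i F i) = \sum_i flatten_mx (F i).
Proof.
apply: (big_morph flatten_mx flatten_mxD).
by apply/matrixP=> p q; rewrite !mxE e0 mxE.
Qed.

Lemma snorm_map_beta g X :
  snorm (flatten_mx (map_mx (beta g) X)) <= (N * N)%:R * snorm (flatten_mx X).
Proof.
apply: snorm_le => p q; rewrite !mxE; apply: beta_le => a b.
by rewrite -flatten_mx_rank; exact: cnorm_entry.
Qed.

Definition fixed_mx (Z : 'M[A]_N) : Prop :=
  exists2 X, flatten_mx X = Z & forall g, map_mx (beta g) X = X.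

Lemma fixed_mx_closed_subalgebra : closed_subalgebra fixed_mx.
Proof.
split.
- exists 1%:M; first exact: flatten_mx1.
  move=> g; apply/matrixP=> i j; rewrite !mxE.
  by case: (i == j); rewrite /= ?mulr1n ?mulr0n ?(hom1 (beta_hom g)) ?(hom0 (beta_hom g)).
- move=> r _ [X <- XF]; exists (map_mx (fun x => rs r * x) X); first exact: flatten_mxZ.
  move=> g; rewrite -[in RHS](XF g); apply/matrixP=> i j; rewrite !mxE.
  by rewrite (homM (beta_hom g)) (hom_rs (beta_hom g)).
- move=> _ _ [X <- XF] [Y <- YF]; exists (X + Y); first exact: flatten_mxD.
  move=> g; rewrite -[in RHS](XF g) -[in RHS](YF g); apply/matrixP=> i j.
  by rewrite !mxE (homD (beta_hom g)).
- move=> _ _ [X <- XF] [Y <- YF]; exists (X *m Y); first exact: flatten_mxM.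
  move=> g; rewrite -[in RHS](XF g) -[in RHS](YF g); apply/matrixP=> i j.
  rewrite !mxE (hom_sum (beta_hom g)); apply: eq_bigr => k _.
  by rewrite !mxE (homM (beta_hom g)).
move=> Z hZ; have [X XZ] := flatten_mx_surj Z; exists X => // g.
apply: flatten_mx_inj; apply/eqP; rewrite -subr_eq0; apply/eqP.
apply: (@snorm_small _ _ _ _ _ ((N * N)%:R + 1)) => d d0.
have [_ [[Y <- YF]]] := hZ d d0; rewrite -XZ -flatten_mxB => XY.
(* Subtracting the fixed approximant Y leaves two terms governed by X - Y; [beta_le] bounds the
   first. *)
have -> : flatten_mx (map_mx (beta g) X) - flatten_mx X =
    flatten_mx (map_mx (beta g) (X - Y)) - flatten_mx (X - Y).
  rewrite -!flatten_mxB -{2}(YF g); congr flatten_mx; apply/matrixP=> i j.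
  by rewrite !mxE (homB (beta_hom g)) !opprB addrA subrK.
apply: le_trans (snormB _ _) _; rewrite mulrDl mul1r; apply: lerD => //.
by apply: le_trans (snorm_map_beta _ _) _; apply: ler_wpM2l.
Qed.

(* Flattened, the average is a sum of positive matrices whose square root lies in
   the closed algebra of fixed matrices. *)
Lemma avg_positive (k : T) (M : 'M[T]_n) : mxpositive M ->
  exists2 X : 'M[T]_n, (forall g, map_mx (beta g) X = X) &
    map_mx (fun x => avg beta (star k * x * k)) M = mxadj X *m X.
Proof.
move=> [X0 ->].
(* With M = X0* X0, the g-th term of the average is Ng* Ng. *)
pose Ng g : 'M[T]_n := map_mx (fun x => beta g (x * k)) X0.
set E := map_mx _ _; pose r : R := (#|gT|%:R)^-1.
have EE : E = map_mx (fun x => rs r * x) (\sum_g mxadj (Ng g) *m Ng g).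
  apply/matrixP=> i j; rewrite !mxE; congr (_ * _); rewrite summxE.
  apply: eq_bigr => g _; rewrite mxE mulr_sumr mulr_suml (hom_sum (beta_hom g)).
  apply: eq_bigr => l _; rewrite !mxE -(hom_star (beta_hom g)) -(homM (beta_hom g)).
  by rewrite starM !mulrA.
have FE : flatten_mx E = rs r *: \sum_g hadj (flatten_mx (Ng g)) *m flatten_mx (Ng g).
  rewrite EE flatten_mxZ flatten_mx_sum; congr (_ *: _).
  by apply: eq_bigr => g _; rewrite flatten_mxM flatten_mx_hadj.
have hadj0 : hadj (0 : 'M[A]_N) = 0.
  by apply/matrixP=> p q; rewrite !mxE star0.
have E_sa : hadj (flatten_mx E) = flatten_mx E.
  rewrite FE hadjZ (big_morph (@hadj R A N N) (@hadjD R A N N) hadj0).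
  by congr (_ *: _); apply: eq_bigr => g _; rewrite hadjM hadjK.
have E_pos v : cpos (ip v (flatten_mx E *m v)).
  rewrite FE -scalemxAl ipZr; apply: cposZ; first by rewrite invr_ge0 ler0n.
  rewrite mulmx_suml (big_morph (ip v) (ipDr v) (ip0r v)); apply: cpos_sum => g _.
  by rewrite -mulmxA -ip_hadj; exact: sq_cpos.
have EF : fixed_mx (flatten_mx E).
  exists E => // g; apply/matrixP=> i j; rewrite !mxE.
  exact: avg_fixed.
have [_ [[X <- XF] X_sa /esym EX]] :=
  psd_sqrt E_sa E_pos fixed_mx_closed_subalgebra EF.
exists X => //; apply: flatten_mx_inj.
by rewrite flatten_mxM flatten_mx_hadj X_sa.
Qed.

End Flatten.

Variables (C : set T) (alpha : gT -> A -> A) (j : A -> T).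
Hypotheses (C_fixed : C = fixed_points beta)
  (alpha_act : star_action alpha) (alpha_nt : exists g, alpha g <> id)
  (j_hom : star_hom_on [set: A] j) (j_inj : injective j)
  (j_central : forall a c, C c -> c * j a = j a * c)
  (beta_j : forall g a, beta g (j a) = j (alpha g a)).

Lemma avg_j a : avg beta (j a) = j (avg alpha a).
Proof.
rewrite /avg (homM j_hom) (hom_rs j_hom) (hom_sum j_hom).
by congr (_ * _); apply: eq_bigr => g _; rewrite beta_j.
Qed.

(** The factor X supplied by [avg_positive] has entries in C, where [iota] is a *-homomorphism, so
    its image factors the image of M. On C, the weight moves past c and leaves c E(k^2) = c. *)
Lemma weighted_avg_pseudo_expectation (I : cstarAlgType R) (iota : T -> I) (k : A) :
  star_hom_on C iota -> star k = k -> avg alpha (k * k) = 1 ->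
  pseudo_expectation C iota (fun x => iota (avg beta (star (j k) * x * j k))).
Proof.
move=> iota_hom k_sa k1.
have C_sub : linear_subspace C by rewrite C_fixed; exact: fixed_points_subspace.
have C_avg x : C (avg beta x) by rewrite C_fixed; exact: avg_fixed.
have jk_sa : star (j k) = j k by rewrite -(hom_star j_hom) k_sa.
have [lin _ mul st] := iota_hom.
split; [split|].
- move=> a x y _ _.
  rewrite mulrDr mulrDl -scalerAr -scalerAl (avg_linear beta_hom).
  exact: lin.
- rewrite mulr1 jk_sa -(homM j_hom) avg_j k1 (hom1 j_hom).
  by have [_ ->] := iota_hom.
- move=> n M _ /(@avg_positive n (j k))[X XF EX]; exists (map_mx iota X).
  have CX a b : C (X a b).
    by rewrite C_fixed => g; rewrite -[in RHS](XF g) mxE.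
  have -> : map_mx (fun x => iota (avg beta (star (j k) * x * j k))) M =
      map_mx iota (mxadj X *m X).
    by rewrite -EX; apply/matrixP=> a b; rewrite !mxE.
  apply/matrixP=> a b; rewrite !mxE.
  have CstX c d : C (star (X c d)).
    by rewrite C_fixed => g; rewrite (hom_star (beta_hom g)) -[in RHS](XF g) mxE.
  have CXX c : C (star (X c a) * X c b).
    move: (CX c b) (CstX c a); rewrite C_fixed => h1 h2 g.
    by rewrite (homM (beta_hom g)) h1 h2.
  have -> : \sum_c mxadj X a c * X c b = \sum_c star (X c a) * X c b.
    by apply: eq_bigr => c _; rewrite !mxE.
  rewrite (hom_on_sum C_sub iota_hom) //; apply: eq_bigr => c _.
  by rewrite !mxE mul // st.
move=> c Cc; congr iota.
have cF : fixed_points beta c by rewrite -C_fixed.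
rewrite jk_sa -j_central // -mulrA -(homM j_hom) (avgMl beta_hom) // avg_j k1.
by rewrite (hom1 j_hom) mulr1.
Qed.

(** At j(k^2) the weight 1 gives E(k^2) = 1 and the weight k gives E(k^4), which differs from 1;
    [iota] and j are faithful enough to keep the values apart. *)
Theorem fixed_points_multiple_pseudo_expectations :
  multiple_pseudo_expectations C.
Proof.
move=> I iota [iota_hom iota_inj _ _].
have [k [k_sa k1 k4]] := exists_weight alpha_act alpha_nt.
have one1 : avg alpha (1 * 1) = 1 by rewrite mulr1 avg1 // => g; exact: action_hom.
have P1 := weighted_avg_pseudo_expectation iota_hom (@star1 R A) one1.
have Pk := weighted_avg_pseudo_expectation iota_hom k_sa k1.
do 2! eexists; split; [exact: P1|exact: Pk|].
have C_avg x : C (avg beta x) by rewrite C_fixed; exact: avg_fixed.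
move=> /(congr1 (fun f => f (j (k * k)))) /iota_inj; do 2 move=> /(_ (C_avg _)).
rewrite -!(hom_star j_hom) -!(homM j_hom) !avg_j => /j_inj.
rewrite star1 mul1r mulr1 k1 k_sa => e4; apply: k4.
by rewrite [RHS]e4; congr (avg _ _); ring.
Qed.

End MatrixModel.

(** * The two inclusions *)

Section FixedPointAlgebra.
Variables (R : realType) (A : comCstarAlgType R) (gT : finGroupType).
Variable alpha : gT -> A -> A.
Hypotheses (alpha_act : star_action alpha) (alpha_nt : exists g, alpha g <> id).

Let ah : forall g, star_hom_on [set: A] (alpha g). Proof. exact: action_hom. Qed.

Lemma fixed_points_multiple : multiple_pseudo_expectations (fixed_points alpha).
Proof.
pose e (a : A) : 'M[A]_1 := a%:M; pose e' (M : 'M[A]_1) := M 0 0.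
have eE a i j : e a i j = a by rewrite !ord1 mxE.
apply: (@fixed_points_multiple_pseudo_expectations R A gT A 1 e e' alpha _ _ _ _ _ _ _
  _ _ _ _ alpha id) => //.
- by move=> a; rewrite /e' eE.
- by move=> M; apply/matrixP=> i j; rewrite eE !ord1.
- by move=> a b; apply/matrixP=> i j; rewrite [RHS]mxE !eE.
- by move=> r a; apply/matrixP=> i j; rewrite [RHS]mxE !eE.
- by move=> a b; apply/matrixP=> i j; rewrite [RHS]mxE big_ord1 !eE.
- by move=> a; apply/matrixP=> i j; rewrite [RHS]hadjE !eE.
- exact: action_mulg.
- move=> g a c h i j; rewrite eE; apply: le_trans (hom_contractive _ (ah g)) _.
  by rewrite -(eE a 0 0).
- by move=> a c _; rewrite mulrC.
Qed.

Let T : starAlgType R := tensorB A gT.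

(** Right translation by g, transported to matrix indices. *)
Definition shift (g : gT) (i : 'I_#|gT|) : 'I_#|gT| := enum_rank (enum_val i * g)%g.

Lemma shift_inj g : injective (shift g).
Proof. by move=> i j /enum_rank_inj/mulIg/enum_val_inj. Qed.

(* The action alpha (x) Ad rho on A (x) B(l^2 G), rho the right regular
   representation. *)
Definition twisted (g : gT) (x : T) : T :=
  \matrix_(i, j) alpha g ((x : 'M[A]_#|gT|) (shift g i) (shift g j)).

Lemma twistedE g (x : T) i j :
  (twisted g x : 'M[A]_#|gT|) i j = alpha g ((x : 'M[A]_#|gT|) (shift g i) (shift g j)).
Proof. by rewrite mxE. Qed.

Lemma twisted_hom g : star_hom_on [set: T] (twisted g).
Proof.
split.
- move=> a x y _ _; apply/matrixP=> i j.
  by rewrite !mxE (homD (ah g)) (homZ (ah g)).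
- apply/matrixP=> i j; rewrite !mxE (inj_eq (@shift_inj g)).
  by case: (i == j); rewrite /= ?mulr1n ?mulr0n ?(hom1 (ah g)) ?(hom0 (ah g)).
- move=> x y _ _; apply/matrixP=> i j; rewrite !mxE (hom_sum (ah g)).
  rewrite (reindex_inj (@shift_inj g)); apply: eq_bigr => k _.
  by rewrite !mxE (homM (ah g)).
- by move=> x _; apply/matrixP=> i j; rewrite !mxE (hom_star (ah g)).
Qed.

Lemma twistedM g h x : twisted (g * h)%g x = twisted g (twisted h x).
Proof.
apply/matrixP=> i j; rewrite !mxE (action_mulg alpha_act).
by rewrite /shift !enum_rankK !mulgA.
Qed.

Lemma fixed_cstar_subalgebra : cstar_subalgebra (fixed_points twisted).
Proof.
split.
- exact: fixed_points_subspace twisted_hom.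
- by move=> x y xF yF g; rewrite (homM (twisted_hom g)) xF yF.
- by move=> x xF g; rewrite (hom_star (twisted_hom g)) xF.
move=> p pcl g; apply/matrixP=> i j; rewrite twistedE.
apply/eqP; rewrite -subr_eq0; apply/eqP/cnorm_eq0/ler_addgt0Pr => d d0; rewrite add0r.
have d2 : 0 < d / 2 by exact: divr_gt0.
(* In the entrywise topology, this neighbourhood of p contains a fixed matrix z; since alpha_g is
   contractive, p is fixed up to d. *)
have [|z [zF pz]] := pcl [set M | forall i j,
    cnorm ((p : 'M[A]_#|gT|) i j - (M : 'M[A]_#|gT|) i j) < d / 2].
  exists (fun i j => [set y | cnorm ((p : 'M[A]_#|gT|) i j - y) < d / 2]) => // a b.
  by rewrite nbhs_cnorm; exists (d / 2).
have := zF g => /matrixP/(_ i j); rewrite twistedE => zg.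
apply: le_trans (ler_cnorm_trans ((z : 'M[A]_#|gT|) i j) _ _) _.
rewrite -{1}zg -(homB (ah g)) (cnormB (_ i j)).
have := hom_contractive ((p : 'M[A]_#|gT|) (shift g i) (shift g j)
  - (z : 'M[A]_#|gT|) (shift g i) (shift g j)) (ah g).
have := pz (shift g i) (shift g j); have := pz i j; rewrite /=; lra.
Qed.

Lemma diagonalE a i j :
  ((\sum_(g : gT) tens (alpha g^-1%g a) (mxunit R g g) : T) : 'M[A]_#|gT|) i j =
  if i == j then alpha (enum_val i)^-1%g a else 0.
Proof.
rewrite summxE (bigD1 (enum_val i)) //= big1 => [|g gi]; rewrite !mxE.
  by rewrite enum_valK eqxx eq_sym /=; case: eqP; rewrite ?scale1r ?scale0r addr0.
have /negPf-> : i != enum_rank g by apply: contra gi => /eqP->; rewrite enum_rankK.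
by rewrite scale0r.
Qed.

Lemma left_regularE g i j :
  (tens (1 : A) (left_regular R g) : 'M[A]_#|gT|) i j =
  (enum_val i == g * enum_val j)%g%:R.
Proof.
rewrite mxE summxE (bigD1 (enum_val j)) //= big1 => [|h hj]; rewrite !mxE.
  rewrite enum_valK eqxx andbT addr0 -(inj_eq enum_val_inj) enum_rankK.
  by case: eqP; rewrite ?scale1r ?scale0r.
have /negPf-> : j != enum_rank h by apply: contra hj => /eqP->; rewrite enum_rankK.
by rewrite andbF.
Qed.

(** The generators are fixed because left and right translations commute and the diagonal copies of
    A are covariant. Conversely, a fixed matrix is determined by its row at the identity, and this
    writes it as a finite sum of products of generators. *)
Lemma crossed_product_fixed : crossed_product alpha = fixed_points twisted.
Proof.
apply/seteqP; split=> x.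
  apply; split; first exact: fixed_cstar_subalgebra.
  move=> _ [[a _ <-]|[s _ <-]] g; apply/matrixP=> i j; rewrite twistedE.
    rewrite !diagonalE (inj_eq (@shift_inj g)); case: eqP => _; last exact: hom0 (ah g).
    rewrite -(action_mulg alpha_act) enum_rankK invMg mulgA mulgV mul1g.
    by [].
  rewrite !left_regularE !enum_rankK mulgA (inj_eq (mulIg g)).
  by case: (_ == _); rewrite ?(hom1 (ah g)) ?(hom0 (ah g)).
move=> xF S [[[S0 Slin] SM Sst _] genS].
(* The Fourier coefficients of x: invariance under i^-1 gives x_(i,j) = alpha_(i^-1)(x_(1, j i^-1)),
   the contribution of s = i j^-1. *)
pose a s := (x : 'M[A]_#|gT|) (enum_rank 1%g) (enum_rank s^-1%g).
pose D s : T := \sum_(g : gT) tens (alpha g^-1%g (a s)) (mxunit R g g).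
pose L s : T := tens (1 : A) (left_regular R s).
have -> : x = \sum_s D s * L s.
  apply/matrixP=> i j; rewrite summxE.
  pose s := (enum_val i * (enum_val j)^-1)%g.
  have DL t : ((D t * L t : T) : 'M[A]_#|gT|) i j =
      if t == s then alpha (enum_val i)^-1%g (a t) else 0.
    rewrite mxE (bigD1 i) //= big1 => [|k /negPf ki]; rewrite diagonalE.
      rewrite eqxx left_regularE addr0.
      have -> : (enum_val i == t * enum_val j)%g = (t == s).
        by rewrite -[RHS](inj_eq (mulIg (enum_val j))) mulgKV eq_sym.
      by case: eqP; rewrite ?mulr1 ?mulr0.
    by rewrite eq_sym ki mul0r.
  rewrite (bigD1 s) //= big1 => [|t /negPf ts]; rewrite DL ?ts ?eqxx // addr0.
  have /matrixP/(_ i j) := xF (enum_val i)^-1%g; rewrite twistedE => <-.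
  by rewrite /shift /a mulgV /s invMg invgK.
have SD s : S (D s * L s).
  by apply: SM; apply: genS; [left; exists (a s)|right; exists s].
apply: (big_ind S) => // y z Sy Sz.
by rewrite -(scale1r y); exact: Slin.
Qed.

(** j embeds A as the scalar matrices; they are central because A is commutative, and the twisted
    action restricts to alpha on them. *)
Lemma crossed_product_multiple : multiple_pseudo_expectations (crossed_product alpha).
Proof.
pose e (x : T) : 'M[A]_#|gT| := x; pose e' (M : 'M[A]_#|gT|) : T := M.
pose j (a : A) : T := (a%:M : 'M[A]_#|gT|).
apply: (@fixed_points_multiple_pseudo_expectations R A gT T #|gT| e e' twisted _ _ _ _ _ _ _
  _ _ _ _ alpha j) => //.
- by move=> r x; rewrite rsM; apply/matrixP=> i k; rewrite !mxE rsM.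
- exact: twisted_hom.
- exact: twistedM.
- move=> g x c h i k; rewrite /e twistedE.
  exact: le_trans (hom_contractive _ (ah g)) (h _ _).
- exact: crossed_product_fixed.
- split.
  + move=> a x y _ _; apply/matrixP=> i k; rewrite !mxE.
    by case: (i == k); rewrite /= ?mulr1n ?mulr0n ?scaler0 ?addr0.
  + by [].
  + by move=> x y _ _; exact: scalar_mxM.
  + move=> x _; apply/matrixP=> i k; rewrite !mxE eq_sym.
    by case: eqP; rewrite /= ?mulr1n ?mulr0n ?star0.
- move=> x y /matrixP/(_ (enum_rank 1%g) (enum_rank 1%g)).
  by rewrite !mxE eqxx !mulr1n.
- move=> a c _; exact: (scalar_mxC a (c : 'M[A]_#|gT|)).
- move=> g a; apply/matrixP=> i k; rewrite twistedE !mxE (inj_eq (@shift_inj g)).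
  by case: (i == k); rewrite /= ?mulr1n ?mulr0n ?(hom0 (ah g)).
Qed.

End FixedPointAlgebra.

Theorem theorem3p30 (R : realType) (A : cstarAlgType R) (gT : finGroupType)
    (alpha : gT -> A -> A) :
  (forall x y : A, x * y = y * x) ->
  star_action alpha ->
  (exists g : gT, alpha g <> id) ->
  multiple_pseudo_expectations (fixed_points alpha) /\
  multiple_pseudo_expectations (crossed_product alpha).
Proof.
(* A is unpacked and repacked on the same carrier and class with commutativity added, so the
   statements for [A1] convert to those for A. *)
case: A alpha => A cls alpha comm alpha_act alpha_nt.
pose A0 := @CStarAlgebra.Pack R A cls.
pose A1 : comCstarAlgType R :=
  HB.pack A cls (GRing.PzRing_hasCommutativeMul.Build A0 comm).
split.
  exact: (@fixed_points_multiple R A1 gT alpha alpha_act alpha_nt).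
exact: (@crossed_product_multiple R A1 gT alpha alpha_act alpha_nt).
Qed.
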